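(* Let $\mathcal A_{ML}$ be the MLMC estimator based on $\{X_\ell\}$ satisfying Assumption A with $\gamma\ge\beta$, suppose Assumption B holds, and suppose that for every $\nu>0$ $$\lim_{\ell\to\infty}\mathbf 1_{\{V_\ell>0\}}\,\mathbb E\Big[\frac{|\Delta_\ell X-\mathbb E[\Delta_\ell X]|^2}{V_\ell}\mathbf 1\Big\{\frac{|\Delta_\ell X-\mathbb E[\Delta_\ell X]|^2}{V_\ell}>e^{(2\alpha-\gamma)\ell}S_\ell^2\,\nu\Big\}\Big]=0.$$ Then the normalized MLMC estimator satisfies the extended CLT condition.
   Context: Let $(\Omega,\mathcal F,\mathbb P)$ be a probability space, $X\in L^2(\Omega)$ a real random variable and $\{X_\ell\}_{\ell=-1}^\infty\subset L^2(\Omega)$ with $X_{-1}:=0$. Put $\Delta_\ell X:=X_\ell-X_{\ell-1}$, $V_\ell:=\mathrm{Var}(\Delta_\ell X)$, and let $C_\ell>0$ denote the (given) cost of sampling $\Delta_\ell X$. Assumption A: there are positive constants $\alpha,\beta,\gamma$ with $\min(\beta,\gamma)\le 2\alpha$, and $c_\alpha>0$, such that for all $\ell\in\mathbb N_0$: $|\mathbb E[X-X_\ell]|\le c_\alpha e^{-\alpha\ell}$; $V_\ell\le C e^{-\beta\ell}$ for some constant $C>0$; and $c e^{\gamma\ell}<C_\ell<C' e^{\gamma\ell}$ for constants $0<c<C'$. Define $S_k:=\sum_{\ell=0}^k\sqrt{V_\ell C_\ell}$. MLMC estimator: for $\epsilon>0$, $L(\epsilon):=\max(\lceil \log(c_\alpha\epsilon^{-1})/\alpha\rceil,1)$,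 $M_\ell(\epsilon):=\max\big(\lceil \epsilon^{-2}\sqrt{V_\ell/C_\ell}\,S_{L(\epsilon)}\rceil,1\big)$, and $\mathcal A_{ML}(\epsilon):=\sum_{\ell=0}^{L(\epsilon)}\frac{1}{M_\ell(\epsilon)}\sum_{i=1}^{M_\ell(\epsilon)}\Delta_\ell X^i$, where the family $\{\Delta_\ell X^i\}$ is mutually independent and each $\Delta_\ell X^i$ has the law of $\Delta_\ell X$. Conventions: $0\cdot(\pm\infty)=0$, $0/0=0$. Assumption B: $V_0>0$; if $\beta=\gamma$ then $\lim_{k\to\infty}S_k=\infty$; if $\gamma>\beta$ then $\beta<2\alpha$ and there exists $\upsilon\in[\beta,2\alpha)$ with $\liminf_{k\to\infty}S_k e^{(\upsilon-\gamma)k/2}>1$. Extended CLT condition: $\frac{\mathcal A_{ML}(\epsilon)-\mathbb E[X_{L(\epsilon)}]}{\sqrt{\mathrm{Var}(\mathcal A_{ML}(\epsilon))}}\xrightarrow{d}\mathcal N(0,1)$ as $\epsilon\downarrow0$, and $\lim_{\epsilon\downarrow0}\max_{0\le\ell\le L(\epsilon)}\frac{V_\ell}{M_\ell(\epsilon)^2\,\mathrm{Var}(\mathcal A_{ML}(\epsilon))}=0$. *)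

(* Defs.v *)
From HB Require Import structures.
From mathcomp Require Import all_boot all_order all_algebra.
From mathcomp Require Import all_classical all_reals all_analysis.
Set Implicit Arguments. Unset Strict Implicit. Unset Printing Implicit Defensive.
Import Order.TTheory GRing.Theory Num.Theory.
Import numFieldNormedType.Exports.
Local Open Scope classical_set_scope.
Local Open Scope ring_scope.

Section MLMC.
Context {d : measure_display} {T : measurableType d} {R : realType}.
Variable P : probability T R.

Definition Delta (Xs : nat -> T -> R) (l : nat) : T -> R :=
  if l is l'.+1 then (Xs l'.+1 \- Xs l')%R else Xs 0%N.

(* V_l := Var(Delta_l X) (finite for L^2 variables) *)
Definition Vl (Xs : nat -> T -> R) (l : nat) : R := fine ('V_P[Delta Xs l]).

Definition Sk (Xs : nat -> T -> R) (C : nat -> R) (k : nat) : R :=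
  \sum_(l < k.+1) Num.sqrt (Vl Xs l * C l).

Definition Leps (alpha calpha eps : R) : nat :=
  `|Num.max (Num.ceil (ln (calpha / eps) / alpha)) 1%Z|%N.

Definition Meps (Xs : nat -> T -> R) (C : nat -> R) (alpha calpha eps : R)
    (l : nat) : nat :=
  `|Num.max (Num.ceil (eps ^- 2 * Num.sqrt (Vl Xs l / C l)
                         * Sk Xs C (Leps alpha calpha eps))) 1%Z|%N.

(* A_ML(eps) := sum_{l=0}^{L} 1/M_l sum_{i=1}^{M_l} Delta_l X^i ;
   the copies are D (l, i), i = 0 .. M_l - 1 *)
Definition AML (Xs : nat -> T -> R) (C : nat -> R) (D : nat * nat -> T -> R)
    (alpha calpha eps : R) : T -> R :=
  fun w => \sum_(l < (Leps alpha calpha eps).+1)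
     (Meps Xs C alpha calpha eps l)%:R^-1 *
     \sum_(i < Meps Xs C alpha calpha eps l) D (nat_of_ord l, nat_of_ord i) w.

Definition mutually_independent {I : eqType} (D : I -> T -> R) : Prop :=
  (forall j, measurable_fun setT (D j)) /\
  forall (J : seq I) (B : I -> set R), uniq J -> (forall j, measurable (B j)) ->
    P (\bigcap_(j in [set j | j \in J]) (D j @^-1` B j)) =
    (\prod_(j <- J) P (D j @^-1` B j))%E.

Definition same_law (Y Z : T -> R) : Prop :=
  forall B : set R, measurable B -> P (Y @^-1` B) = P (Z @^-1` B).

(* convergence in distribution of Z eps (eps --> F) to the law mu on R:
   convergence of the cdfs at every continuity point of the limit cdf *)
Definition cvg_in_distribution (F : set_system R) (Z : R -> T -> R)
    (mu : set R -> \bar R) : Prop :=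
  forall x : R, mu [set x] = 0%E ->
    (P (Z e @^-1` [set` `]-oo, x]]) @[e --> F] --> mu [set` `]-oo, x]]).

Definition extended_CLT (Xs : nat -> T -> R) (C : nat -> R)
    (D : nat * nat -> T -> R) (alpha calpha : R) : Prop :=
  cvg_in_distribution 0^'+
    (fun eps w => (AML Xs C D alpha calpha eps w
                   - fine ('E_P[Xs (Leps alpha calpha eps)]))
                  / Num.sqrt (fine ('V_P[AML Xs C D alpha calpha eps])))
    (normal_prob 0 1)
  /\
  ((\big[Num.max/0]_(l < (Leps alpha calpha eps).+1)
      (Vl Xs l / ((Meps Xs C alpha calpha eps l)%:R ^+ 2
                  * fine ('V_P[AML Xs C D alpha calpha eps]))))
     @[eps --> 0^'+] --> 0).

End MLMC.

(* Main.v *)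
Require Import Defs.
From HB Require Import structures.
From mathcomp Require Import all_boot all_order all_algebra.
From mathcomp Require Import all_classical all_reals all_analysis.
From mathcomp Require Import measurable_realfun.
From mathcomp Require Import ring lra.
Import Order.TTheory GRing.Theory Num.Theory.
Import numFieldNormedType.Exports.
Local Open Scope classical_set_scope.
Local Open Scope ring_scope.

(** Put [K_l := e^((2 alpha - gamma) l) S_l^2].  Assumption B makes [K_l] tend to
    infinity, and [eps e^(alpha L)] stays bounded, so rounding the sample numbers
    up costs little: [Var A_ML >= eps^2 / 2] for small [eps].  Writing the
    normalized estimator as a sum of independent centred variables of variance
    [q_l = V_l / (M_l^2 Var A_ML)], one gets
    [q_l <= const * eps^2 C_l / S_L^2 <= const / K_l], and [q_l -> 0] uniformly in
    [l <= L].  The truncation level of the classical Lindeberg condition, seen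
    from [|Delta_l X - E|^2 / V_l], is [nu^2 / q_l]: the first bound lets the
    hypothesis of the theorem handle all large [l], the second the finitely many
    remaining ones.

    The Lindeberg central limit theorem is proved by replacement: for a smooth
    [f], exchanging one summand for a centred Gaussian of the same variance
    changes [E f] by a Taylor remainder only.  The Gaussians are never realized
    as random variables; they act on test functions through the semigroup
    [f |-> E f(x + s Z)]. *)

(** No Gaussian average is ever differentiated. A test function travels with two companions standing
    for its first and half its second derivative, constrained only by sup bounds and remainder
    estimates. Averaging all three preserves these estimates with the same constant, by linearity of
    the integral, so one constant serves every replacement in a sum whose length grows as eps
    decreases. A single explicit piecewise cubic, rescaled, suffices as test function: only smoothed
    indicators of half-lines are needed, and the normal distribution function is Lipschitz, so
    smoothing costs as little as desired.

    The variance bound rests on an exact identity: with unrounded sample numbers the variance of the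
    estimator would be eps^2. Rounding loses at most eps^4 (sum of C_l, l <= L) / S_L^2. Costs grow
    geometrically, so their sum is of order e^(gamma L), and eps = O(e^(-alpha L)) makes the loss
    O(eps^2 / K_L). *)

Set Implicit Arguments. Unset Strict Implicit. Unset Printing Implicit Defensive.

(** * Test functions with a two-sided Taylor bound *)

Section taylor_class.
Context {R : realType}.
Implicit Types (f a b : R -> R) (K x h t : R).

Definition taylor_rem f a b x h : R := f (x + h) - (f x + a x * h + b x * h ^+ 2).

(* The Lindeberg argument uses the quadratic bound on the event where a summand
   is large and the cubic bound elsewhere; [a] and [b] play the roles of [f']
   and [f'' / 2]. *)
Record taylor_class K f a b : Prop := TaylorClass {
  taylor_mf : measurable_fun setT f;
  taylor_ma : measurable_fun setT a;
  taylor_mb : measurable_fun setT b;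
  taylor_bf : forall x, `|f x| <= K;
  taylor_ba : forall x, `|a x| <= K;
  taylor_bb : forall x, `|b x| <= K;
  taylor_rem2 : forall x h, `|taylor_rem f a b x h| <= K * h ^+ 2;
  taylor_rem3 : forall x h, `|taylor_rem f a b x h| <= K * `|h| ^+ 3 }.

(** Truncated power. At n = 0 it is the constant 1, also for negative t, which is why [spline3P]
    asks for a positive exponent. *)
Definition posp (n : nat) t : R := Num.max t 0 ^+ n.

(** Third backward difference of truncated powers: for n = 2 it is twice the quadratic B-spline with
    knots 0, 1, 2, 3, and its derivative is n times the same expression with exponent n - 1. *)
Definition spline3 (n : nat) t : R :=
  posp n t - 3 * posp n (t - 1) + 3 * posp n (t - 2) - posp n (t - 3).

(* One minus the integral of the quadratic B-spline: a C^2 transition from 1 to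
   0 on [0, 3] with Lipschitz second derivative. *)
Definition step t : R := 1 - spline3 3 t / 6.

(** The third derivative of the truncated cube takes only the values 0 and 6, so the remainder
    constant is 6 / 3! = 1. The kink at 0 forces the four sign cases. *)
Lemma posp_taylor x h :
  `|posp 3 (x + h) - (posp 3 x + 3 * posp 2 x * h + 3 * posp 1 x * h ^+ 2)|
  <= `|h| ^+ 3.
Proof.
rewrite /posp expr1; have [u0|u0] := leP 0 (x + h); have [x0|x0] := leP 0 x.
- have -> : (x + h) ^+ 3 - (x ^+ 3 + 3 * x ^+ 2 * h + 3 * x * h ^+ 2) = h ^+ 3.
    by ring.
  by rewrite normrX.
- have h0 : 0 <= h by lra.
  rewrite !expr0n/= !(mulr0, mul0r) !addr0 subr0 ger0_norm ?exprn_ge0//.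
  by rewrite ger0_norm// lerXn2r ?nnegrE//; lra.
- have -> : 0 ^+ 3 - (x ^+ 3 + 3 * x ^+ 2 * h + 3 * x * h ^+ 2)
      = - ((- h) ^+ 3 - (- (x + h)) ^+ 3) by ring.
  rewrite normrN (ler0_norm (_ : h <= 0)); last by lra.
  have uh : (- (x + h)) ^+ 3 <= (- h) ^+ 3 by rewrite lerXn2r ?nnegrE//; lra.
  by rewrite ger0_norm ?subr_ge0// gerBl exprn_ge0//; lra.
- rewrite !expr0n/= !(mulr0, mul0r) !addr0 subr0 normr0 exprn_ge0//.
Qed.

(** The constant is the sum 1 + 3 + 3 + 1 of the absolute difference coefficients. *)
Lemma spline3_taylor x h :
  `|spline3 3 (x + h) - (spline3 3 x + 3 * spline3 2 x * h
      + 3 * spline3 1 x * h ^+ 2)| <= 8 * `|h| ^+ 3.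
Proof.
rewrite /spline3 -![x + h - _]addrAC.
have := posp_taylor x h; have := posp_taylor (x - 1) h.
have := posp_taylor (x - 2) h; have := posp_taylor (x - 3) h.
rewrite !ler_norml; move: (posp _) (`|h| ^+ 3) => p H.
move=> /andP[? ?] /andP[? ?] /andP[? ?] /andP[? ?]; apply/andP; split; nra.
Qed.

Variant spline3_spec n t : R -> Type :=
| Spline0 of t <= 0 : spline3_spec n t 0
| Spline1 of 0 <= t <= 1 : spline3_spec n t (t ^+ n)
| Spline2 of 1 <= t <= 2 : spline3_spec n t (t ^+ n - 3 * (t - 1) ^+ n)
| Spline3 of 2 <= t <= 3 :
    spline3_spec n t (t ^+ n - 3 * (t - 1) ^+ n + 3 * (t - 2) ^+ n)
| Spline4 of 3 <= t : spline3_spec n t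
    (t ^+ n - 3 * (t - 1) ^+ n + 3 * (t - 2) ^+ n - (t - 3) ^+ n).

Lemma spline3P n t : (0 < n)%N -> spline3_spec n t (spline3 n t).
Proof.
move=> n0; have z x : x <= 0 -> posp n x = 0.
  by move=> x0; rewrite /posp max_r// expr0n gtn_eqF.
have p x : 0 <= x -> posp n x = x ^+ n by move=> x0; rewrite /posp max_l.
rewrite /spline3; have [t0|/ltW t0] := leP t 0.
  by rewrite !z; [rewrite !mulr0 !subr0 addr0; apply: Spline0|lra..].
have [t1|/ltW t1] := leP t 1.
  rewrite p; last lra.
  by rewrite !z; [rewrite !mulr0 !subr0 addr0; apply: Spline1; lra|lra..].
have [t2|/ltW t2] := leP t 2.
  rewrite !(p t) ?(p (t - 1)); try lra.
  by rewrite !z; [rewrite !mulr0 subr0 addr0; apply: Spline2; lra|lra..].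
have [t3|/ltW t3] := leP t 3.
  rewrite !(p t) ?(p (t - 1)) ?(p (t - 2)); try lra.
  by rewrite !z; [rewrite subr0; apply: Spline3; lra|lra..].
by rewrite !p; [apply: Spline4|lra..].
Qed.

Lemma spline3_3_itv t : 0 <= spline3 3 t <= 6.
Proof.
case: spline3P => // H; [lra| | | |].
- have : t ^+ 3 <= 1 by rewrite exprn_ile1//; lra.
  have : 0 <= t ^+ 3 by rewrite exprn_ge0//; lra.
  lra.
(* With u = t - 1 this piece equals 1 + 3 u + (3 u^2 - 2 u^3); the two products say that 3 u^2 - 2
   u^3 lies between 0 and 1. *)
- have p1 : 0 <= (t - 1) ^+ 2 * (3 - 2 * (t - 1)).
    by rewrite mulr_ge0 ?sqr_ge0//; lra.
  have p2 : 0 <= (2 - t) ^+ 2 * (1 + 2 * (t - 1)).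
    by rewrite mulr_ge0 ?sqr_ge0//; lra.
  apply/andP; split; lra.
- have -> : t ^+ 3 - 3 * (t - 1) ^+ 3 + 3 * (t - 2) ^+ 3 = 6 - (3 - t) ^+ 3.
    by ring.
  have : (3 - t) ^+ 3 <= 1 by rewrite exprn_ile1//; lra.
  have : 0 <= (3 - t) ^+ 3 by rewrite exprn_ge0//; lra.
  lra.
- have -> : t ^+ 3 - 3 * (t - 1) ^+ 3 + 3 * (t - 2) ^+ 3 - (t - 3) ^+ 3 = 6.
    by ring.
  by lra.
Qed.

Lemma spline3_2_itv t : `|spline3 2 t| <= 6.
Proof.
by rewrite ler_norml; case: spline3P => // H; apply/andP; split; nra.
Qed.

Lemma spline3_1_itv t : `|spline3 1 t| <= 6.
Proof.
rewrite ler_norml; case: spline3P => // H; rewrite ?expr1; apply/andP; split; lra.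
Qed.

Lemma step_itv t : 0 <= step t <= 1.
Proof. by rewrite /step; have := spline3_3_itv t; lra. Qed.

Lemma step_le0 t : t <= 0 -> step t = 1.
Proof.
move=> t0; rewrite /step /spline3 /posp.
by rewrite !max_r ?expr0n/=; lra.
Qed.

Lemma step_ge3 t : 3 <= t -> step t = 0.
Proof.
by move=> t3; rewrite /step /spline3 /posp !max_l; lra.
Qed.

Lemma measurable_posp n : measurable_fun setT (posp n).
Proof. by apply: measurable_funX; exact: measurable_maxr. Qed.

Lemma measurable_spline3 n : measurable_fun setT (spline3 n).
Proof.
have m c : measurable_fun setT (fun t => posp n (t - c)).
  by apply: measurableT_comp; [exact: measurable_posp|exact: measurable_funB].
apply: measurable_funB; last exact: m.
apply: measurable_funD; last by apply: measurable_funM => //; exact: m.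
apply: measurable_funB; first exact: measurable_posp.
by apply: measurable_funM => //; exact: m.
Qed.

Lemma step_taylor : taylor_class 10 step (fun t => - spline3 2 t / 2)
  (fun t => - spline3 1 t / 2).
Proof.
have ms := measurable_spline3.
have rem3 x h : `|taylor_rem step (fun t => - spline3 2 t / 2)
    (fun t => - spline3 1 t / 2) x h| <= 2 * `|h| ^+ 3.
  have := spline3_taylor x h; rewrite /taylor_rem /step !ler_norml.
  by move: (spline3 _) (`|h| ^+ 3) => s H /andP[? ?]; apply/andP; split; lra.
split.
- by apply: measurable_funB => //; apply: measurable_funM.
- by apply: measurable_funM => //; exact: measurableT_comp.
- by apply: measurable_funM => //; exact: measurableT_comp.
- by move=> x; have := step_itv x; rewrite ler_norml; lra.
- by move=> x; have := spline3_2_itv x; rewrite !ler_norml; lra.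
- by move=> x; have := spline3_1_itv x; rewrite !ler_norml; lra.
- move=> x h; have h0 := normr_ge0 h.
  (* For small h the quadratic bound follows from the cubic one; for large h the terms are bounded
     separately, by 1 + 3 |h| + 3 h^2 <= 10 h^2. *)
  have [h1|h1] := leP `|h| 1.
    apply: (le_trans (rem3 x h)); rewrite -(real_normK (num_real h)).
    by rewrite exprS; nra.
  have := step_itv x; have := step_itv (x + h); have := spline3_2_itv x.
  have := spline3_1_itv x; rewrite /taylor_rem.
  have hh : `|h| <= h ^+ 2 by rewrite -(real_normK (num_real h)); nra.
  have hh1 : 1 <= h ^+ 2 by lra.
  move: hh; rewrite !ler_norml => /andP[hh2 hh3] /andP[? ?] /andP[? ?].
  by move=> /andP[? ?] /andP[? ?]; apply/andP; split; nra.
- move=> x h; apply: (le_trans (rem3 x h)).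
  by rewrite ler_wpM2r ?exprn_ge0//; lra.
Qed.

(** The factor (1 + r)^3 dominates 1, r, r^2 and r^3 at once, so all the bounds keep a common
    constant. *)
Lemma taylor_class_affine K f a b r c : 0 <= r -> taylor_class K f a b ->
  taylor_class (K * (1 + r) ^+ 3) (fun x => f (r * (x - c)))
    (fun x => a (r * (x - c)) * r) (fun x => b (r * (x - c)) * r ^+ 2).
Proof.
move=> r0 [mf ma mb bf ba bb rem2 rem3].
have K0 : 0 <= K by rewrite (le_trans _ (bf 0)).
have maff : measurable_fun setT (fun x => r * (x - c)).
  by apply: measurable_funM => //; exact: measurable_funB.
have r1 n : (n <= 3)%N -> r ^+ n <= (1 + r) ^+ 3.
  move=> n3; apply: (@le_trans _ _ ((1 + r) ^+ n)).
    by rewrite lerXn2r ?nnegrE//; lra.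
  by rewrite ler_weXn2l//; lra.
have remE x h : taylor_rem (fun x => f (r * (x - c)))
    (fun x => a (r * (x - c)) * r) (fun x => b (r * (x - c)) * r ^+ 2) x h
    = taylor_rem f a b (r * (x - c)) (r * h).
  rewrite /taylor_rem; have -> : r * (x + h - c) = r * (x - c) + r * h by ring.
  by ring.
split.
- exact: measurableT_comp.
- by apply: measurable_funM => //; exact: measurableT_comp.
- by apply: measurable_funM => //; exact: measurableT_comp.
- move=> x; apply: (le_trans (bf _)); rewrite ler_peMr//.
  by have := r1 0%N isT; rewrite expr0.
- move=> x; rewrite normrM (ger0_norm r0) ler_pM//.
  by have := r1 1%N isT; rewrite expr1.
- by move=> x; rewrite normrM (ger0_norm (exprn_ge0 _ r0)) ler_pM ?exprn_ge0// r1.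
- move=> x h; rewrite remE; apply: (le_trans (rem2 _ _)).
  by rewrite exprMn mulrA ler_wpM2r ?sqr_ge0// ler_wpM2l// r1.
- move=> x h; rewrite remE; apply: (le_trans (rem3 _ _)).
  by rewrite normrM exprMn mulrA ler_wpM2r ?exprn_ge0// ler_wpM2l// ger0_norm// r1.
Qed.

End taylor_class.

(** * Moments of the normal distribution *)

Section normal_moments.
Context {R : realType}.
Notation mu := (@lebesgue_measure R).

(** Change of variables yields the Radon-Nikodym derivative, known only up to null sets; it agrees
    almost everywhere with [normal_pdf] because both have the same integral over every measurable
    set. *)
Lemma ge0_integral_normal_prob m s (f : R -> \bar R) :
  measurable_fun setT f -> (forall x, 0 <= f x)%E ->
  (\int[normal_prob m s]_x f x = \int[mu]_x (f x * (normal_pdf m s x)%:E))%E.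
Proof.
move=> mf f0; have numu := normal_prob_dominates m s.
rewrite -(Radon_Nikodym_SigmaFinite.change_of_variables numu)//.
have intg := Radon_Nikodym_SigmaFinite.f_integrable numu.
apply: ae_eq_integral => //.
- by apply: emeasurable_funM => //; exact: measurable_int intg.
- apply: emeasurable_funM => //.
  by apply/measurable_EFinP; exact: measurable_normal_pdf.
- apply: ae_eqe_mul2l => /=; apply: integral_ae_eq => //.
  + by apply/measurable_EFinP; exact: measurable_normal_pdf.
  + by move=> E _ mE; rewrite -Radon_Nikodym_SigmaFinite.f_integral.
Qed.

Lemma integrable_normal_prob m s (f : R -> R) : measurable_fun setT f ->
  (normal_prob m s).-integrable setT (EFin \o f) <->
  mu.-integrable setT (EFin \o (fun x => f x * normal_pdf m s x)).
Proof.
move=> mf; have mp := measurable_normal_pdf m s.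
have E : (\int[normal_prob m s]_x `|(f x)%:E| =
    \int[mu]_x `|(f x * normal_pdf m s x)%:E|)%E.
  rewrite ge0_integral_normal_prob//; last first.
    by apply: measurableT_comp => //; exact/measurable_EFinP.
  apply: eq_integral => x _ /=.
  by rewrite normrM EFinM (ger0_norm (normal_pdf_ge0 _ _ _)).
split=> /integrableP[_ fi]; apply/integrableP; split.
- exact/measurable_EFinP/measurable_funM.
- by rewrite -E.
- exact/measurable_EFinP.
- by rewrite E.
Qed.

Lemma Rintegral_normal_prob m s (f : R -> R) : measurable_fun setT f ->
  (normal_prob m s).-integrable setT (EFin \o f) ->
  \int[normal_prob m s]_x f x = \int[mu]_x (f x * normal_pdf m s x).
Proof.
move=> mf; have mp := measurable_normal_pdf m s.
move=> intf; have /(integrable_normal_prob _ _ mf) intfp := intf.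
rewrite /Rintegral integralE [in RHS]integralE; congr (fine (_ - _)%E).
- rewrite ge0_integral_normal_prob//.
    apply: eq_integral => x _.
    rewrite !funeposE /= -!EFin_max -EFinM; congr EFin.
    by rewrite maxr_pMl ?mul0r ?normal_pdf_ge0.
  by apply: measurable_funepos; exact/measurable_EFinP.
- rewrite ge0_integral_normal_prob//.
    apply: eq_integral => x _.
    rewrite !funenegE /= -!EFin_max -EFinM; congr EFin.
    by rewrite maxr_pMl ?mul0r ?mulNr ?normal_pdf_ge0.
  by apply: measurable_funeneg; exact/measurable_EFinP.
Qed.

(** Fundamental theorem of calculus on [-n, n], then dominated convergence. With suitable F it
    replaces integration by parts in the two moment computations. *)
Lemma Rintegral_derive_eq0 (F f : R -> R) :
  (forall x, is_derive x (1 : R) F (f x)) -> continuous f ->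
  mu.-integrable setT (EFin \o f) ->
  F n%:R @[n --> \oo] --> 0 -> F (- n%:R) @[n --> \oo] --> 0 ->
  \int[mu]_x f x = 0.
Proof.
move=> dF cf intf F1 F2.
pose f_ (n : nat) := (EFin \o f) \_ `[(- n%:R : R), n%:R].
have mf : measurable_fun setT (EFin \o f) by exact: measurable_int intf.
have [//|||_ _ Hcvg] := @dominated_convergence _ _ _ mu setT measurableT f_
    (EFin \o f) (fun x => `|f x|%:E) _ mf _ (integrable_norm intf) _.
- by move=> n; apply/(measurable_restrictT _ _).1 => //=; exact: measurable_funTS.
- apply: aeW => x _; apply: cvg_near_cst; near=> n.
  rewrite /f_ patchE mem_set//= in_itv/= -ler_norml.
  by near: n; exact: nbhs_infty_ger.
- apply: aeW => x n _; rewrite /f_ patchE.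
  by case: ifPn => //= _; rewrite normr0 lee_fin.
have {}Hcvg : (\int[mu]_x f_ n x @[n --> \oo] --> \int[mu]_x (f x)%:E)%E by [].
suff H0 : (\int[mu]_x f_ n x @[n --> \oo] --> 0)%E.
  by rewrite /Rintegral (cvg_unique _ Hcvg H0).
have E n : (0 < n)%N -> (\int[mu]_x f_ n x = (F n%:R - F (- n%:R))%:E)%E.
  move=> n0; rewrite /f_ -integral_mkcond EFinB.
  have dF1 x : derivable F x 1 by have [] := dF x.
  apply: continuous_FTC2.
  - by rewrite -subr_gt0 opprK addr_gt0// ltr0n.
  - exact: continuous_subspaceT.
  - split => //.
    + apply: cvg_at_right_filter; apply: differentiable_continuous.
      exact/derivable1_diffP.
    + apply: cvg_at_left_filter; apply: differentiable_continuous.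
      exact/derivable1_diffP.
  - by move=> x _; rewrite derive1E; have [] := dF x.
apply: cvg_trans (_ : (F n%:R - F (- n%:R))%:E @[n --> \oo] --> 0%E).
  apply: near_eq_cvg; near=> n; rewrite E//.
  by near: n; exact: nbhs_infty_gt.
apply: cvg_EFin; first exact: nearW.
rewrite -[X in _ --> X](subrr 0).
exact: cvgB.
Unshelve. all: by end_near. Qed.


Local Notation N := (normal_prob (0 : R) (1 : R)).
Local Notation phi := (normal_pdf (0 : R) (1 : R)).

Lemma std_normal_pdfE x : phi x = normal_peak 1 * expR (- x ^+ 2 / 2).
Proof. by rewrite normal_pdfE ?oner_neq0// /normal_fun subr0 expr1n. Qed.

Lemma integrable_normal_X4 : N.-integrable setT (EFin \o (fun x : R => x ^+ 4)).
Proof.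
have mp := measurable_normal_pdf (0 : R) 1.
apply/integrable_normal_prob => //.
have s2 : Num.sqrt 2 != 0 :> R by rewrite gt_eqF// sqrtr_gt0.
have p2 := normal_peak_gt0 s2.
(* Domination by the density of standard deviation sqrt 2: from 1 + x^2 / 8 <= e^(x^2 / 8) one gets
   x^2 e^(-x^2 / 8) <= 8, hence x^4 e^(-x^2 / 4) <= 64. *)
pose k : R := 64 * normal_peak 1 / normal_peak (Num.sqrt 2).
have H := integrableZl measurableT k (@integrable_normal_pdf R 0 (Num.sqrt 2)).
apply: (le_integrable measurableT _ _ H).
- by apply/measurable_EFinP; apply: measurable_funM.
- move=> x _ /=; rewrite lee_fin std_normal_pdfE normal_pdfE//.
  have p1 : 0 < normal_peak (1 : R) by rewrite normal_peak_gt0 ?oner_neq0.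
  rewrite /normal_fun subr0 sqr_sqrtr//.
  set e := expR (- x ^+ 2 / (2 *+ 2)).
  have e0 : 0 < e by exact: expR_gt0.
  have x2 : 0 <= x ^+ 2 by exact: sqr_ge0.
  have -> : expR (- x ^+ 2 / 2) = e ^+ 2.
    by rewrite -expRM_natl /e; congr expR; field.
  have e8 : (1 + x ^+ 2 / 8) * expR (- x ^+ 2 / 8) <= 1.
    rewrite mulNr expRN ler_pdivrMr ?expR_gt0// mul1r.
    exact: expR_ge1Dx.
  have ee : e = expR (- x ^+ 2 / 8) ^+ 2.
    by rewrite -expRM_natl /e; congr expR; field.
  have x4e : x ^+ 4 * e <= 64.
    rewrite ee; set u := expR _ in e8 *.
    have u0 : 0 <= u by exact: expR_ge0.
    have -> : x ^+ 4 * u ^+ 2 = (x ^+ 2 * u) ^+ 2 by ring.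
    have : x ^+ 2 * u <= 8 by nra.
    have : 0 <= x ^+ 2 * u by rewrite mulr_ge0.
    nra.
  rewrite ger0_norm; last first.
    by rewrite (exprM x 2 2) mulr_ge0 ?sqr_ge0// mulr_ge0 ?sqr_ge0// ltW.
  apply: le_trans (ler_norm _).
  have -> : k * (normal_peak (Num.sqrt 2) * e) = 64 * normal_peak 1 * e.
    by rewrite /k; field; rewrite gt_eqF.
  have -> : x ^+ 4 * (normal_peak 1 * e ^+ 2) = (x ^+ 4 * e) * (normal_peak 1 * e).
    by ring.
  by rewrite -[leRHS]mulrA ler_wpM2r// mulr_ge0 ?ltW.
Qed.

(** The fourth moment controls the lower ones through |x|^n <= 1 + x^4. *)
Lemma integrable_normal_Xn n : (n <= 4)%N ->
  N.-integrable setT (EFin \o (fun x : R => `|x| ^+ n)).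
Proof.
move=> n4; have H := integrableD measurableT
  (@finite_measure_integrable_cst _ _ _ N setT 1 measurableT)
  integrable_normal_X4.
apply: (le_integrable measurableT _ _ H).
- by apply/measurable_EFinP; apply: measurable_funX => //.
- move=> x _ /=; rewrite lee_fin normrX normr_id.
  have x0 := normr_ge0 x; have -> : x ^+ 4 = `|x| ^+ 4.
    by rewrite (exprM x 2 2) -(real_normK (num_real x)) -exprM.
  rewrite (ger0_norm (addr_ge0 ler01 (exprn_ge0 _ x0))).
  have [x1|/ltW x1] := leP `|x| 1.
    by apply: (@le_trans _ _ 1); [rewrite exprn_ile1|rewrite lerDl exprn_ge0].
  by apply: (@le_trans _ _ (`|x| ^+ 4)); [rewrite ler_weXn2l|rewrite lerDr].
Qed.

Lemma integrable_normal_poly n : (n <= 4)%N ->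
  N.-integrable setT (EFin \o (fun x : R => x ^+ n)).
Proof.
move=> n4; apply: (le_integrable measurableT _ _ (integrable_normal_Xn n4)).
  by apply/measurable_EFinP; apply: measurable_funX => //.
by move=> x _ /=; rewrite lee_fin !normrX normr_id.
Qed.

Lemma is_derive_std_normal_pdf x : is_derive x (1 : R) phi (- x * phi x).
Proof.
rewrite (_ : phi = fun x => normal_peak 1 * expR (- x ^+ 2 / 2)); last first.
  by apply/funext => y; exact: std_normal_pdfE.
by apply: is_derive_eq; rewrite !scaler1 /GRing.scale /=; field.
Qed.

(** Decay of the boundary terms of both moment computations. The inequality 1 + x^2 / 2 <= e^(x^2 /
    2) bounds x phi(x) by a multiple of 1 / x; shifting n by one avoids x = 0. *)
Lemma std_normal_pdf_cvg0 :
  (n%:R * phi n%:R) @[n --> \oo] --> 0 /\ phi n%:R @[n --> \oo] --> 0.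
Proof.
have p1 : 0 < normal_peak (1 : R) by rewrite normal_peak_gt0 ?oner_neq0.
have H n : n.+1%:R * phi n.+1%:R <= 2 * normal_peak 1 * (n.+1%:R)^-1.
  rewrite std_normal_pdfE; set x : R := n.+1%:R.
  have x0 : 0 < x by rewrite ltr0n.
  have : (1 + x ^+ 2 / 2) * expR (- x ^+ 2 / 2) <= 1.
    rewrite mulNr expRN ler_pdivrMr ?expR_gt0// mul1r; exact: expR_ge1Dx.
  set e := expR _ => he; have e0 : 0 <= e by exact: expR_ge0.
  rewrite ler_pdivlMr//.
  suff : x ^+ 2 * e <= 2 by move=> ?; nra.
  nra.
have ph n : 0 <= phi n%:R by exact: normal_pdf_ge0.
have c0 : (2 * normal_peak 1 * n.+1%:R^-1 : R) @[n --> \oo] --> 0.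
  by rewrite -[X in _ --> X](mulr0 (2 * normal_peak 1)); apply: cvgM;
    [exact: cvg_cst|exact: cvg_harmonic].
split; rewrite -cvg_shiftS; apply: (squeeze_cvgr _ (cvg_cst _) c0);
  apply: nearW => n /=.
- by rewrite H andbT mulr_ge0.
- by rewrite ph/=; apply: le_trans (H n); rewrite ler_peMl// ler1n.
Qed.

Lemma std_normal_pdfN x : phi (- x) = phi x.
Proof. by rewrite !std_normal_pdfE sqrrN. Qed.

Lemma continuous_std_normal_pdf : continuous phi.
Proof. exact: continuous_normal_pdf (oner_neq0 R). Qed.

Let integrable_phi_poly n : (n <= 4)%N ->
  mu.-integrable setT (EFin \o (fun x : R => x ^+ n * phi x)).
Proof.
move=> n4; apply/integrable_normal_prob; last exact: integrable_normal_poly.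
exact: exprn_measurable.
Qed.

(* [phi' x = - x phi x]. *)
Lemma normal_mean : \int[N]_x x = 0.
Proof.
have i1 := @integrable_normal_poly 1 isT.
rewrite Rintegral_normal_prob//.
have E : \int[mu]_x (- (x * phi x)) = - \int[mu]_x (x * phi x).
  rewrite -[RHS]mulN1r -RintegralZl//; last exact: (@integrable_phi_poly 1).
  by apply: eq_Rintegral => x _; rewrite mulN1r.
apply: oppr_inj; rewrite oppr0 -E.
have [_ p0] := std_normal_pdf_cvg0.
apply: (@Rintegral_derive_eq0 phi) => //.
- by move=> x; rewrite -mulNr; exact: is_derive_std_normal_pdf.
- move=> x; apply: (@cvgN _ R^o); apply: cvgM; first exact: cvg_id.
  exact: continuous_std_normal_pdf.
- apply: (eq_integrable measurableT); last exact: (integrableN (@integrable_phi_poly 1 isT)).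
  by move=> x _ /=; rewrite expr1.
- by under eq_fun do rewrite std_normal_pdfN.
Qed.

(* [(x phi x)' = phi x - x^2 phi x]. *)
Lemma normal_variance : \int[N]_x x ^+ 2 = 1.
Proof.
have i2 := @integrable_phi_poly 2 isT.
have i0 := @integrable_normal_pdf R 0 1.
rewrite Rintegral_normal_prob//; last exact: integrable_normal_poly.
have E : \int[mu]_x (phi x - x ^+ 2 * phi x) = 1 - \int[mu]_x (x ^+ 2 * phi x).
  by rewrite RintegralB// {1}/Rintegral integral_normal_pdf.
apply/esym/eqP; rewrite -subr_eq0 -E; apply/eqP.
have [p0 _] := std_normal_pdf_cvg0.
apply: (@Rintegral_derive_eq0 (fun x => x * phi x)) => //.
- move=> x; have := is_derive_std_normal_pdf x => dphi.
  by apply: is_derive_eq; rewrite /GRing.scale /=; ring.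
- move=> x; apply: (@cvgB _ R^o); first exact: continuous_std_normal_pdf.
  apply: cvgM; last exact: continuous_std_normal_pdf.
  exact: exprn_continuous.
- exact: (integrableB measurableT i0 i2).
- under eq_fun do rewrite std_normal_pdfN mulNr.
  by have := cvgN p0; rewrite oppr0; apply.
Qed.

End normal_moments.

(** * Bounds for integrals against a probability *)

Section probability_integrals.
Context d (T : measurableType d) (R : realType) (P : probability T R).
Implicit Types f g : T -> R.

Lemma bounded_integrable f K : measurable_fun setT f ->
  (forall x, `|f x| <= K) -> P.-integrable setT (EFin \o f).
Proof.
move=> mf bf; apply: (le_integrable measurableT _ _
  (finite_measure_integrable_cst P K measurableT)).
  exact/measurable_EFinP.
by move=> x _ /=; rewrite lee_fin (le_trans (bf x))// ler_norm.
Qed.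

Lemma Rintegral_probability_cst K : \int[P]_x K = K.
Proof. by rewrite Rintegral_cst//= probability_setT mulr1. Qed.

Lemma le_normr_Rintegral_dominated f g : measurable_fun setT f ->
  P.-integrable setT (EFin \o g) -> (forall x, `|f x| <= g x) ->
  `|\int[P]_x f x| <= \int[P]_x g x.
Proof.
move=> mf ig fg; have intf : P.-integrable setT (EFin \o f).
  apply: (le_integrable measurableT _ _ ig); first exact/measurable_EFinP.
  by move=> x _ /=; rewrite lee_fin (le_trans (fg x))// ler_norm.
apply: (le_trans (le_normr_Rintegral measurableT intf)).
apply: le_Rintegral => //; exact: integrable_norm.
Qed.

Lemma le_normr_Rintegral_bounded f K : measurable_fun setT f ->
  (forall x, `|f x| <= K) -> `|\int[P]_x f x| <= K.
Proof.
move=> mf bf; rewrite -[leRHS]Rintegral_probability_cst.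
apply: le_normr_Rintegral_dominated => //.
exact: finite_measure_integrable_cst.
Qed.

End probability_integrals.

(** * Gaussian averages *)

Section gauss_avg.
Context {R : realType}.
Notation mu := (@lebesgue_measure R).
Local Notation N := (normal_prob (0 : R) (1 : R)).
Local Notation phi := (normal_pdf (0 : R) (1 : R)).
Implicit Types (f a b : R -> R) (s t x : R).

(* Integrating against the standard normal law, rather than [normal_prob x s],
   makes [s = 0] the identity: [normal_prob x 0] is uniform on [0, 1]. *)
Definition gauss_avg s f x : R := \int[N]_z f (x + s * z).

Let measurable_aff s x : measurable_fun setT (fun z : R => x + s * z).
Proof. by apply: measurable_funD => //; exact: measurable_funM. Qed.

Let measurable_shift f s x : measurable_fun setT f ->
  measurable_fun setT (fun z : R => f (x + s * z)).
Proof. by move=> mf; exact: measurableT_comp (measurable_aff _ _). Qed.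

Lemma measurable_gauss_avg s f K : measurable_fun setT f ->
  (forall x, `|f x| <= K) -> measurable_fun setT (gauss_avg s f).
Proof.
move=> mf bf.
(* Adding K makes the integrand nonnegative, as Tonelli requires; K is subtracted again
   afterwards. *)
pose g (p : R * R) := (f (p.1 + s * p.2) + K)%:E.
have mg : measurable_fun setT g.
  apply/measurable_EFinP; apply: measurable_funD => //.
  apply: measurableT_comp => //; apply: measurable_funD => //.
  by apply: measurable_funM.
have g0 p : (0 <= g p)%E.
  by rewrite lee_fin; have := bf (p.1 + s * p.2); rewrite ler_norml; lra.
have mF := @measurable_fun_fubini_tonelli_F _ _ _ (measurableTypeR R) R N g mg g0.
have -> : gauss_avg s f = (fun x => fine (fubini_F N g x) - K).
  apply/funext => x; rewrite /fubini_F /g.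
  have if1 : N.-integrable setT (EFin \o (fun z => f (x + s * z))).
    by apply: (@bounded_integrable _ _ _ N _ K) => //; exact: measurable_shift.
  have -> : fine (\int[N]_y (f (x + s * y) + K)%:E) =
    \int[N]_y (f (x + s * y) + K) by [].
  rewrite RintegralD//; last exact: finite_measure_integrable_cst.
  by rewrite Rintegral_probability_cst addrK.
by apply: measurable_funB => //; exact: measurableT_comp.
Qed.

Lemma gauss_avg_bounded s f K x : measurable_fun setT f ->
  (forall x, `|f x| <= K) -> `|gauss_avg s f x| <= K.
Proof.
by move=> mf bf; apply: le_normr_Rintegral_bounded => //; exact: measurable_shift.
Qed.

Lemma gauss_avg_taylor_rem s K f a b x h : taylor_class K f a b ->
  taylor_rem (gauss_avg s f) (gauss_avg s a) (gauss_avg s b) x h =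
  \int[N]_z taylor_rem f a b (x + s * z) h.
Proof.
move=> [mf ma mb bf ba bb _ _].
have i (g : R -> R) (y : R) : measurable_fun setT g -> (forall x, `|g x| <= K) ->
    N.-integrable setT (EFin \o (fun z => g (y + s * z))).
  by move=> mg bg; apply: (@bounded_integrable _ _ _ N _ K) => //; exact: measurable_shift.
have iM (g : R -> R) (y k : R) : measurable_fun setT g -> (forall x, `|g x| <= K) ->
    N.-integrable setT (EFin \o (fun z => g (y + s * z) * k)).
  move=> mg bg; have := integrableZr measurableT k (i g y mg bg).
  by apply: eq_integrable.
have iD := integrableD measurableT (i f x mf bf) (iM a x h ma ba).
have iDD := integrableD measurableT iD (iM b x (h ^+ 2) mb bb).
transitivity (\int[N]_z (f (x + h + s * z)
    - (f (x + s * z) + a (x + s * z) * h + b (x + s * z) * h ^+ 2))).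
  rewrite RintegralB//; last exact: i.
  rewrite RintegralD//; last exact: iM.
  by rewrite RintegralD ?RintegralZr//; [exact: i|exact: i|exact: i|exact: iM].
by apply: eq_Rintegral => z _; rewrite /taylor_rem addrAC.
Qed.

(** The remainder of the average is the average of the remainders, so each bound passes through an
    integral of total mass 1 with K unchanged. *)
Lemma gauss_avg_taylor_class s K f a b : taylor_class K f a b ->
  taylor_class K (gauss_avg s f) (gauss_avg s a) (gauss_avg s b).
Proof.
move=> tf; have [mf ma mb bf ba bb rem2 rem3] := tf.
have mrem (x h : R) : measurable_fun setT (fun z => taylor_rem f a b (x + s * z) h).
  rewrite /taylor_rem; apply: measurable_funB.
    by under eq_fun do rewrite addrAC; exact: measurable_shift.
  apply: measurable_funD; first apply: measurable_funD.
  - exact: measurable_shift.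
  - by apply: measurable_funM => //; exact: measurable_shift.
  by apply: measurable_funM => //; exact: measurable_shift.
split.
- exact: measurable_gauss_avg mf bf.
- exact: measurable_gauss_avg ma ba.
- exact: measurable_gauss_avg mb bb.
- by move=> x; exact: gauss_avg_bounded.
- by move=> x; exact: gauss_avg_bounded.
- by move=> x; exact: gauss_avg_bounded.
- move=> x h; rewrite (gauss_avg_taylor_rem _ _ _ tf).
  by apply: le_normr_Rintegral_bounded => [|z]; [exact: mrem|exact: rem2].
- move=> x h; rewrite (gauss_avg_taylor_rem _ _ _ tf).
  by apply: le_normr_Rintegral_bounded => [|z]; [exact: mrem|exact: rem3].
Qed.

Definition normal_abs3 : R := \int[N]_z (`|z| ^+ 3).

(** Taylor expansion with increment s z: the linear term has mean 0, the quadratic one has mean b(x)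
    s^2, and the cubic remainder bound is integrated. *)
Lemma gauss_avg_expansion s K f a b x : 0 <= s -> taylor_class K f a b ->
  `|gauss_avg s f x - (f x + b x * s ^+ 2)| <= K * normal_abs3 * s ^+ 3.
Proof.
move=> s0 [mf ma mb bf ba bb rem2 rem3].
have if1 : N.-integrable setT (EFin \o (fun z => f (x + s * z))).
  by apply: (@bounded_integrable _ _ _ N _ K) => //; exact: measurable_shift.
have ic : N.-integrable setT (EFin \o (fun=> f x)).
  exact: finite_measure_integrable_cst.
have i1 : N.-integrable setT (EFin \o (fun z => a x * s * z)).
  exact: (integrableZl measurableT (a x * s) (@integrable_normal_poly R 1 isT)).
have i2 : N.-integrable setT (EFin \o (fun z => b x * s ^+ 2 * z ^+ 2)).
  exact: (integrableZl measurableT _ (@integrable_normal_poly R 2 isT)).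
have i3 : N.-integrable setT (EFin \o (fun z => K * s ^+ 3 * `|z| ^+ 3)).
  exact: (integrableZl measurableT _ (@integrable_normal_Xn R 3 isT)).
have E : gauss_avg s f x - (f x + b x * s ^+ 2) =
    \int[N]_z taylor_rem f a b x (s * z).
  rewrite /taylor_rem RintegralB//; last first.
    apply: (eq_integrable measurableT _ _ _ (integrableD measurableT
      (integrableD measurableT ic i1) i2)).
    by move=> z _ /=; congr EFin; ring.
  congr (_ - _).
  transitivity (\int[N]_z ((f x + a x * s * z) + b x * s ^+ 2 * z ^+ 2)); last first.
    by apply: eq_Rintegral => z _; ring.
  rewrite RintegralD//; last exact: (integrableD measurableT ic i1).
  rewrite RintegralD// !RintegralZl//.
  + rewrite Rintegral_probability_cst normal_mean normal_variance.
    by rewrite mulr0 addr0 mulr1.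
  + exact: (@integrable_normal_poly R 2).
  + exact: (@integrable_normal_poly R 1).
rewrite E; apply: (@le_trans _ _ (\int[N]_z (K * s ^+ 3 * `|z| ^+ 3))).
  apply: le_normr_Rintegral_dominated => //.
    rewrite /taylor_rem; apply: measurable_funB; first exact: measurable_shift.
    apply: measurable_funD.
      by apply: measurable_funD => //; do 2 apply: measurable_funM => //.
    by apply: measurable_funM => //; apply: measurable_funX; exact: measurable_funM.
  move=> z; apply: (le_trans (rem3 _ _)).
  by rewrite normrM exprMn (ger0_norm s0) mulrA.
rewrite RintegralZl//; last exact: (@integrable_normal_Xn R 3).
by rewrite mulrAC.
Qed.

End gauss_avg.

(** * Composition of Gaussian averages *)

Section gauss_semigroup.
Context {R : realType}.
Notation mu := (@lebesgue_measure R).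
Local Notation N := (normal_prob (0 : R) (1 : R)).
Local Notation phi := (normal_pdf (0 : R) (1 : R)).
Implicit Types (f a b : R -> R) (s t x : R).

(** For |h| <= 1 the quadratic remainder bound gives |f(x + h) - f(x)| <= 3 K |h|; the extra 1 in
    the radius below keeps its denominator positive when K = 0. Continuity is what the substitution
    in [gauss_avg_kernel] asks for. *)
Lemma taylor_class_continuous K f a b : taylor_class K f a b -> continuous f.
Proof.
move=> [mf ma mb bf ba bb rem2 rem3] x.
have K0 : 0 <= K by rewrite (le_trans _ (bf 0)).
apply/cvgrPdist_le => e e0.
have dd : 0 < Num.min 1 (e / (3 * K + 1)).
  by rewrite lt_min ltr01 divr_gt0//; lra.
near=> y.
have : `|x - y| <= Num.min 1 (e / (3 * K + 1)).
  by near: y; move/cvgrPdist_le: (@cvg_id _ (nbhs x)); apply.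
rewrite le_min => /andP[]; set h := y - x.
have -> : `|x - y| = `|h| by rewrite distrC.
move=> h1; rewrite ler_pdivlMr; last by lra.
move=> he; rewrite distrC; have -> : y = x + h by rewrite /h addrC subrK.
have -> : f (x + h) - f x = taylor_rem f a b x h + a x * h + b x * h ^+ 2.
  by rewrite /taylor_rem; ring.
have h0 := normr_ge0 h; have hh : h ^+ 2 <= `|h|.
  by rewrite -(real_normK (num_real h)); nra.
have H1 := rem2 x h.
have H2 : `|a x * h| <= K * `|h| by rewrite normrM ler_wpM2r.
have H3 : `|b x * h ^+ 2| <= K * `|h|.
  by rewrite normrM (ger0_norm (sqr_ge0 h)) ler_pM ?sqr_ge0.
apply: (le_trans (ler_normD _ _)); have := ler_normD (taylor_rem f a b x h) (a x * h).
have : K * h ^+ 2 <= K * `|h| by rewrite ler_wpM2l.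
lra.
Unshelve. all: by end_near. Qed.

Lemma gauss_avg_kernel s f x : 0 < s -> continuous f -> (forall y, 0 <= f y) ->
  (\int[N]_z (f (x + s * z))%:E = \int[mu]_y (f y * normal_pdf x s y)%:E)%E.
Proof.
move=> s0 cf f0; have mf : measurable_fun setT f by exact: continuous_measurable_fun.
have maff : measurable_fun setT (fun z : R => x + s * z).
  by apply: measurable_funD => //; exact: measurable_funM.
rewrite ge0_integral_normal_prob; last 2 first.
- by apply/measurable_EFinP; exact: (measurableT_comp mf).
- by move=> z; rewrite lee_fin.
pose F (z : R) : R := x + s * z.
have dF (z : R) : is_derive z (1 : R) F s.
  by apply: is_derive_eq; rewrite /GRing.scale /=; ring.
have F'E : F^`()%classic = cst s.
  by apply/funext => z; rewrite derive1E; have [] := dF z.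
have sn0 : s != 0 by rewrite gt_eqF.
rewrite [RHS](@increasing_ge0_integration_by_substitutionT R F
  (fun y => f y * normal_pdf x s y)).
- apply: eq_integral => z _; rewrite F'E -EFinM; congr EFin; rewrite !fctE /=.
  rewrite -mulrA; congr (_ * _); rewrite std_normal_pdfE normal_pdfE//.
  rewrite /F /normal_peak /normal_fun addrAC subrr add0r expr1n mul1r.
  rewrite -(mulrnAr (s ^+ 2)) sqrtrM ?sqr_ge0// sqrtr_sqr gtr0_norm// invfM.
  have -> : - (s * z) ^+ 2 / (s ^+ 2 *+ 2) = - z ^+ 2 / 2 by field.
  by move: (expR _) (Num.sqrt _)^-1 => e k; field.
- by move=> y z yz; rewrite /F ltrD2l ltr_pM2l.
- by rewrite F'E => z; exact: cvg_cst.
- by rewrite F'E; exact: is_cvg_cst.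
- by rewrite F'E; exact: is_cvg_cst.
- by move=> z; have [] := dF z.
- rewrite /F; apply/cvgrNyPle => A; near=> z.
  rewrite -lerBrDl -ler_pdivlMl//; near: z.
- rewrite /F; apply/cvgryPge => A; near=> z.
  rewrite -lerBlDl -ler_pdivrMl//; near: z.
- move=> y; apply: cvgM; first exact: cf.
  exact: continuous_normal_pdf.
- by move=> y; rewrite mulr_ge0// normal_pdf_ge0.
Unshelve. all: by end_near. Qed.

(* Completing the square in [z]; integrating over [z] then gives the convolution
   of the two Gaussian kernels. *)
Lemma normal_pdf_comp s t x y : 0 < s -> 0 < t -> exists m v : R, forall z,
  normal_pdf x s z * normal_pdf z t y =
  normal_pdf x (Num.sqrt (s ^+ 2 + t ^+ 2)) y * normal_pdf m v z.
Proof.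
move=> s0 t0; set r := Num.sqrt _.
have q0 : 0 < s ^+ 2 + t ^+ 2 by rewrite addr_gt0 ?exprn_gt0.
have r0 : 0 < r by rewrite sqrtr_gt0.
have r2 : r ^+ 2 = s ^+ 2 + t ^+ 2 by rewrite sqr_sqrtr// ltW.
have v0 : 0 < s * t / r by rewrite divr_gt0 ?mulr_gt0.
(* Conditional mean and standard deviation of the intermediate point z given the end point y of two
   successive Gaussian steps from x. *)
exists ((x * t ^+ 2 + y * s ^+ 2) / r ^+ 2), (s * t / r) => z.
rewrite !normal_pdfE ?gt_eqF// /normal_fun.
rewrite mulrACA [RHS]mulrACA -!expRD; congr (_ * expR _).
  have peakE u : 0 < u -> normal_peak u = u^-1 * (Num.sqrt (pi *+ 2))^-1 :> R.
    move=> u0; rewrite /normal_peak -(mulrnAr (u ^+ 2)) sqrtrM ?sqr_ge0//.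
    by rewrite sqrtr_sqr gtr0_norm// invfM.
  rewrite !peakE//; set c := (Num.sqrt _)^-1.
  by field; rewrite !gt_eqF.
rewrite expr_div_n r2; field.
by rewrite !gt_eqF.
Qed.

(** Written with kernels, the left side is a double integral of a nonnegative function; after
    Tonelli the inner integral over z is that of a single normal density, hence 1. *)
Lemma gauss_avg_comp s t f K x : 0 < s -> 0 < t ->
  continuous f -> continuous (gauss_avg t f) -> (forall y, 0 <= f y <= K) ->
  gauss_avg s (gauss_avg t f) x = gauss_avg (Num.sqrt (s ^+ 2 + t ^+ 2)) f x.
Proof.
move=> s0 t0 cf cTf f0K.
have f0 y : 0 <= f y by have /andP[] := f0K y.
have mf : measurable_fun setT f by exact: continuous_measurable_fun.
have r0 : 0 < Num.sqrt (s ^+ 2 + t ^+ 2).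
  by rewrite sqrtr_gt0 addr_gt0 ?exprn_gt0.
have Tf0 y : 0 <= gauss_avg t f y by apply: Rintegral_ge0.
have gE u g : gauss_avg u g x = fine (\int[N]_z (g (x + u * z))%:E)%E by [].
rewrite !gE; congr fine; rewrite !gauss_avg_kernel//.
have maff z : measurable_fun setT (fun w : R => z + t * w).
  by apply: measurable_funD => //; exact: measurable_funM.
have TfE z : ((gauss_avg t f z)%:E = \int[mu]_y (f y * normal_pdf z t y)%:E)%E.
  rewrite -gauss_avg_kernel// /gauss_avg /Rintegral fineK//.
  apply: integrable_fin_num => //; apply: (@bounded_integrable _ _ _ N _ K).
    exact: (measurableT_comp mf (maff z)).
  by move=> w; rewrite ger0_norm//; have /andP[] := f0K (z + t * w).
pose G (p : R * R) : \bar R := (f p.2 * (normal_pdf x s p.1 * normal_pdf p.1 t p.2))%:E.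
transitivity (\int[mu]_z \int[mu]_y G (z, y))%E.
  apply: eq_integral => z _; rewrite EFinM TfE muleC -ge0_integralZl//.
  - by apply: eq_integral => y _; rewrite /G /= -EFinM; congr EFin; ring.
  - apply/measurable_EFinP/measurable_funM => //; exact: measurable_normal_pdf.
  - by move=> y _; rewrite lee_fin mulr_ge0// normal_pdf_ge0.
  - by rewrite lee_fin normal_pdf_ge0.
rewrite (@fubini_tonelli _ _ (measurableTypeR R) (measurableTypeR R) R mu mu G).
- apply: eq_integral => y _; rewrite /G /=.
  have [m [v E]] := normal_pdf_comp x y s0 t0.
  under eq_integral do rewrite E mulrA EFinM.
  rewrite ge0_integralZl//.
  + by rewrite integral_normal_pdf mule1.
  + by apply/measurable_EFinP; exact: measurable_normal_pdf.
  + by move=> z _; rewrite lee_fin normal_pdf_ge0.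
  + by rewrite lee_fin mulr_ge0// normal_pdf_ge0.
- apply/measurable_EFinP; apply: measurable_funM.
    exact: measurableT_comp.
  apply: measurable_funM.
    by apply: measurableT_comp => //; exact: measurable_normal_pdf.
  rewrite (_ : (fun p : R * R => _) = (fun p : R * R =>
    normal_peak t * expR (- (p.2 - p.1) ^+ 2 / (t ^+ 2 *+ 2)))); last first.
    by apply/funext => p; rewrite normal_pdfE// gt_eqF.
  apply: measurable_funM => //; apply: measurableT_comp => //.
  apply: measurable_funM => //; apply: measurableT_comp => //.
  by apply: measurable_funX; exact: measurable_funB.
- by move=> p; rewrite lee_fin !mulr_ge0// normal_pdf_ge0.
Qed.

Lemma gauss_avg0 f x : gauss_avg 0 f x = f x.
Proof.
rewrite /gauss_avg; under eq_Rintegral do rewrite mul0r addr0.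
exact: Rintegral_probability_cst.
Qed.

(** Standard deviation 0 has no kernel and is treated apart. It does occur: the replacement starts
    from t = 0, and a summand may have variance 0. *)
Lemma gauss_avg_semigroup s t K f a b x : 0 <= s -> 0 <= t ->
  taylor_class K f a b -> (forall y, 0 <= f y) ->
  gauss_avg s (gauss_avg t f) x = gauss_avg (Num.sqrt (s ^+ 2 + t ^+ 2)) f x.
Proof.
move=> + + tf f0; rewrite le_eqVlt => /predU1P[<- t0|s0].
  by rewrite gauss_avg0 expr0n add0r sqrtr_sqr ger0_norm.
rewrite le_eqVlt => /predU1P[<-|t0].
  rewrite expr0n addr0 sqrtr_sqr gtr0_norm//; congr gauss_avg.
  by apply/funext => y; exact: gauss_avg0.
apply: (@gauss_avg_comp _ _ _ K) => //.
- exact: taylor_class_continuous tf.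
- exact: taylor_class_continuous (gauss_avg_taylor_class t tf).
- by move=> y; rewrite f0 (le_trans (ler_norm _))//; case: tf.
Qed.

End gauss_semigroup.

(** * Independence *)

Section independence.
Context d (T : measurableType d) (R : realType) (P : probability T R).
Implicit Types X Y : T -> R.

Definition indep2 X Y := forall A B : set R, measurable A -> measurable B ->
  (P (X @^-1` A `&` Y @^-1` B) = P (X @^-1` A) * P (Y @^-1` B))%E.

(** The lambda-system half of the pi-lambda argument in [mutually_independent_sum]. *)
Lemma indep_dynkin (F : set T) : measurable F ->
  dynkin [set E | measurable E /\ (P (E `&` F) = P E * P F)%E].
Proof.
move=> mF; split => /=.
- by split => //; rewrite setTI probability_setT mul1e.
- move=> E [mE PE]; split; first exact: measurableC.
  rewrite setIC -setDE measureD//; last by rewrite ltey_eq fin_num_measure.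
  rewrite setIC; transitivity (P F - P E * P F)%E.
    by congr (_ - _)%E; exact: PE.
  by rewrite probability_setC// muleBl ?mul1e ?fin_num_measure//.
- move=> E tE HE; have mE n : measurable (E n) by have [] := HE n.
  split; first exact: bigcup_measurable.
  rewrite setI_bigcupl measure_bigcup//; last 2 first.
  + by move=> n _; exact: measurableI.
  + exact: trivIset_setIr.
  rewrite (measure_bigcup P)//.
  have PF : P F = (fine (P F))%:E by rewrite fineK// fin_num_measure.
  rewrite muleC PF -nneseriesZl; last by move=> n _; exact: measure_ge0.
  apply: eq_eseriesr => n _; have [_ En] := HE n.
  by rewrite -PF muleC; exact: En.
Qed.

(** Finite intersections of coordinate events indexed by [J] form a pi-system [G] independent of
    [D j], by the product formula on [j :: J]. Independence extends to the generated sigma-algebra,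
    for which the sum is measurable. *)
Lemma mutually_independent_sum (I : eqType) (D : I -> T -> R) (j : I) (J : seq I) :
  mutually_independent P D -> uniq (j :: J) ->
  indep2 (fun w => \sum_(i <- J) D i w) (D j).
Proof.
move=> [mD indepD] ujJ B A mB mA.
have mDA i (C : set R) : measurable C -> measurable (D i @^-1` C).
  by move=> mC; rewrite -[X in measurable X]setTI; exact: mD.
pose G := [set E : set T | exists C : I -> set R, (forall i, measurable (C i)) /\
  E = \bigcap_(i in [set i | i \in J]) (D i @^-1` C i)].
have GI : setI_closed G.
  move=> _ _ [C1 [mC1 ->]] [C2 [mC2 ->]]; exists (fun i => C1 i `&` C2 i).
  split; first by move=> i; exact: measurableI.
  by rewrite -bigcapI; apply: eq_bigcapr => i _; rewrite preimage_setI.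
have finJ : finite_set [set i | i \in J] by exact: finite_seq.
have mDA' := mDA j A mA.
have GH : G `<=` [set E | measurable E /\
    (P (E `&` (D j @^-1` A)) = P E * P (D j @^-1` A))%E].
  move=> _ [C [mC ->]]; split; first by apply: fin_bigcap_measurable => // i _; exact: mDA.
  (* Puts [A] at the new index and keeps [C] on [J]; consistent because j is not in [J]. *)
  pose C' i := if i == j then A else C i.
  have mC' i : measurable (C' i) by rewrite /C'; case: ifP.
  have jJ : j \notin J by have /andP[] := ujJ.
  have C'E i : i \in J -> C' i = C i.
    by move=> iJ; rewrite /C'; case: eqP => // ij; rewrite -ij iJ in jJ.
  rewrite [in RHS]indepD//; last by have /andP[] := ujJ.
  have := indepD (j :: J) C' ujJ mC'.
  rewrite big_cons {1 2}/C' eqxx muleC => Heq.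
  rewrite (_ : \prod_(i <- J) P (D i @^-1` C i)
    = \prod_(i <- J) P (D i @^-1` C' i))%E; last first.
    by apply: eq_big_seq => i iJ; rewrite C'E.
  rewrite -Heq; congr (P _); apply/seteqP; split=> w /=.
    move=> [h1 h2] i /=; rewrite inE => /predU1P[->|iJ].
      by rewrite /C' eqxx.
    by change (C' i (D i w)); rewrite C'E//; exact: h1.
  move=> h; split; last by have := h j; rewrite /C' /= eqxx; apply; rewrite /= inE eqxx.
  move=> i /= iJ; have : C' i (D i w) by apply: (h i); rewrite /= inE iJ orbT.
  by rewrite C'E.
have mS : measurable_fun setT
    ((fun w => \sum_(i <- J) D i w) : g_sigma_algebraType G -> R).
  (* Only the [D i] with i in [J] are measurable for the sigma-algebra generated by [G]; the other
     indices are given a harmless 0 so that every summand is measurable. *)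
  rewrite (_ : (fun w => _) = (fun w => \sum_(i <- J)
      (if i \in J then D i else cst 0) w)); last first.
    by apply/funext => w; apply: eq_big_seq => i ->.
  apply: measurable_sum => i; case: ifPn => iJ //.
  move=> _ C mC; rewrite setTI; apply: sub_sigma_algebra.
  exists (fun i' => if i' == i then C else setT); split.
    by move=> i'; case: ifP.
  apply/seteqP; split=> w /=.
    by move=> h i' _ /=; case: eqP => [->|].
  by move=> /(_ i iJ) /=; rewrite eqxx.
have : <<s G >> ((fun w => \sum_(i <- J) D i w) @^-1` B).
  by have := mS measurableT _ mB; rewrite setTI.
rewrite -setI_closed_g_dynkin_g_sigma_algebra// => H.
have := smallest_sub (indep_dynkin mDA') GH.
by move=> /(_ _ H) [].
Qed.

(** Independence makes the joint law the product of the marginals, by uniqueness of the product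
    measure; Tonelli gives integrability and Fubini the factorization. *)
Lemma indep2_integrableM X Y : measurable_fun setT X -> measurable_fun setT Y ->
  indep2 X Y ->
  P.-integrable setT (EFin \o X) -> P.-integrable setT (EFin \o Y) ->
  P.-integrable setT (EFin \o (fun w => X w * Y w)) /\
  \int[P]_w (X w * Y w) = (\int[P]_w X w) * (\int[P]_w Y w).
Proof.
move=> mX mY XY iX iY.
pose rX : {RV P >-> R} := mfun_Sub (mem_set mX).
pose rY : {RV P >-> R} := mfun_Sub (mem_set mY).
pose PX : probability R R := distribution P rX.
pose PY : probability R R := distribution P rY.
have mXY : measurable_fun setT (fun w => (X w, Y w)) by exact: measurable_fun_pair.
pose rXY : {RV P >-> (R * R)%type} := mfun_Sub (mem_set mXY).
pose PXY : probability (R * R)%type R := distribution P rXY.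
have PE A : measurable A -> (PX \x PY)%E A = PXY A.
  apply: product_measure_unique => B C mB mC.
  by have := XY B C mB mC.
pose f (p : R * R) := (p.1 * p.2)%:E.
have mf : measurable_fun setT f.
  by apply/measurable_EFinP; exact: measurable_funM.
have absX (Z : {RV P >-> R}) : (\int[distribution P Z]_x `|x%:E| =
    \int[P]_w `|(Z w)%:E|)%E.
  rewrite (ge0_integral_distribution Z)//.
  by apply/measurable_EFinP; exact: normr_measurable.
have if1 : (PX \x PY)%E.-integrable setT f.
  apply/(@integrable12ltyP _ _ _ _ R PX PY f mf); rewrite /f /=.
  have /integrableP[_ iX'] := iX; have /integrableP[_ iY'] := iY.
  under eq_integral => x _.
    under eq_integral => y _ do rewrite normrM EFinM.
    rewrite ge0_integralZl//=; last first.
      by apply/measurable_EFinP; exact: normr_measurable.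
    over.
  have YE : (\int[PY]_y (`|y|%R)%:E = \int[P]_w `|(Y w)%:E|)%E := absX rY.
  have XE : (\int[PX]_x (`|x|%R)%:E = \int[P]_w `|(X w)%:E|)%E := absX rX.
  rewrite YE ge0_integralZr//; last 2 first.
    by apply/measurable_EFinP; exact: normr_measurable.
    exact: integral_ge0.
  rewrite XE.
  have X0 : (0 <= \int[P]_w `|(X w)%:E|)%E by exact: integral_ge0.
  by apply: lte_mul_pinfty => //; rewrite ge0_fin_numE.
have if2 : PXY.-integrable setT f.
  have /integrableP[_ h] := if1; apply/integrableP; split => //.
  by rewrite (eq_measure_integral (PX \x PY)%E)// => A mA _; apply/esym; exact: PE.
have iXY : P.-integrable setT (EFin \o (fun w => X w * Y w)).
  have /integrableP[_ h] := if2; apply/integrableP; split.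
    by apply/measurable_EFinP; exact: measurable_funM.
  move: h; rewrite (ge0_integral_distribution rXY)//.
  exact: measurableT_comp.
split => //.
rewrite /Rintegral -(integral_distribution (X := rXY) (f := f))//.
rewrite (eq_measure_integral (PX \x PY)%E); last first.
  by move=> A mA _; apply/esym; exact: PE.
rewrite -integral12_prod_meas1//.
have iX1 : PX.-integrable setT EFin by apply: integrable_pushforward.
have iY1 : PY.-integrable setT EFin by apply: integrable_pushforward.
rewrite -[in RHS](integral_distribution (X := rX) (f := EFin))//.
rewrite -[in RHS](integral_distribution (X := rY) (f := EFin))//.
rewrite -fineM ?integrable_fin_num//; congr fine.
rewrite /fubini_F /f /=.
under eq_integral => x _.
  under eq_integral => y _ do rewrite EFinM.
  rewrite integralZl//.
  over.
have Yf : (\int[PY]_y y%:E = (fine (\int[PY]_y y%:E))%:E)%E.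
  by rewrite fineK// integrable_fin_num.
by rewrite Yf integralZr.
Qed.

End independence.

(** * Lindeberg's replacement argument *)

Section lindeberg_replacement.
Context d (T : measurableType d) (R : realType) (P : probability T R).
Implicit Types (X Y S : T -> R).

Lemma indep2_comp X Y (f g : R -> R) : measurable_fun setT f ->
  measurable_fun setT g -> indep2 P X Y -> indep2 P (f \o X) (g \o Y).
Proof.
move=> mf mg XY A B mA mB; apply: (XY (f @^-1` A) (g @^-1` B)).
- by rewrite -[X in measurable X]setTI; apply: mf.
- by rewrite -[X in measurable X]setTI; apply: mg.
Qed.

Lemma mutually_independent_comp (I : eqType) (D : I -> T -> R) (g : I -> R -> R) :
  (forall j, measurable_fun setT (g j)) -> mutually_independent P D ->
  mutually_independent P (fun j => g j \o D j).
Proof.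
move=> mg [mD iD]; split=> [j|J B uJ mB]; first exact: measurableT_comp.
apply: (iD J (fun j => g j @^-1` B j)) => // j.
by rewrite -[X in measurable X]setTI; apply: mg.
Qed.

(** One summand of the Lindeberg condition when Y is centred. *)
Definition trunc2 (nu : R) Y : R := \int[P]_w (Y w ^+ 2 * (nu < `|Y w|)%R%:R).

Lemma measurable_trunc2 nu Y : measurable_fun setT Y ->
  measurable_fun setT (fun w => Y w ^+ 2 * (nu < `|Y w|)%R%:R).
Proof.
move=> mY; apply: measurable_funM; first exact: measurable_funX.
rewrite (_ : (fun w => _) = \1_[set w | nu < `|Y w|]); last first.
  apply/funext => w; rewrite indicE; congr (nat_of_bool _)%:R.
  by apply/idP/idP; rewrite inE.
apply: measurable_indic; rewrite -[X in measurable X]setTI.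
have := measurable_fun_ltr (measurable_cst nu) (measurableT_comp (@normr_measurable R setT) mY).
by move=> /(_ measurableT [set true] I).
Qed.

Lemma integrable_trunc2 nu Y : measurable_fun setT Y ->
  P.-integrable setT (EFin \o (fun w => Y w ^+ 2)) ->
  P.-integrable setT (EFin \o (fun w => Y w ^+ 2 * (nu < `|Y w|)%R%:R)).
Proof.
move=> mY iY; apply: (le_integrable measurableT _ _ iY).
  by apply/measurable_EFinP; exact: measurable_trunc2.
move=> w _ /=; rewrite lee_fin normrM ler_piMr// ger0_norm//.
by case: (_ < _).
Qed.

Lemma taylor_rem_le K (f a b : R -> R) nu x h : 0 <= nu -> taylor_class K f a b ->
  `|taylor_rem f a b x h| <= K * (nu * h ^+ 2 + h ^+ 2 * (nu < `|h|)%R%:R).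
Proof.
move=> nu0 [_ _ _ bf _ _ rem2 rem3].
have K0 : 0 <= K by rewrite (le_trans _ (bf 0)).
have [hnu|hnu] /= := ltP nu `|h|.
  apply: (le_trans (rem2 _ _)); rewrite ler_wpM2l// mulr1 lerDr mulr_ge0//.
  exact: sqr_ge0.
apply: (le_trans (rem3 _ _)); rewrite ler_wpM2l// mulr0 addr0.
rewrite exprS -(real_normK (num_real h)) ler_wpM2r//.
Qed.

(* [Y] and [s] times a standard normal variable have the same first two moments,
   so only the Taylor remainders survive. *)
Lemma replacement_step K (f a b : R -> R) nu s S Y : 0 <= nu -> 0 <= s ->
  taylor_class K f a b -> measurable_fun setT S -> measurable_fun setT Y ->
  indep2 P S Y ->
  P.-integrable setT (EFin \o Y) -> \int[P]_w Y w = 0 ->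
  P.-integrable setT (EFin \o (fun w => Y w ^+ 2)) ->
  \int[P]_w (Y w ^+ 2) = s ^+ 2 ->
  `|\int[P]_w f (Y w + S w) - \int[P]_w gauss_avg s f (S w)| <=
  K * (nu * s ^+ 2 + trunc2 nu Y) + K * normal_abs3 * s ^+ 3.
Proof.
move=> nu0 s0 tf mS mY SY iY EY iY2 EY2.
have [mf ma mb bf ba bb _ _] := tf.
have tg := gauss_avg_taylor_class s tf.
have [mg _ _ bg _ _ _ _] := tg.
have iB (g : R -> R) : measurable_fun setT g -> (forall x, `|g x| <= K) ->
    P.-integrable setT (EFin \o (fun w => g (S w))).
  move=> m_g bd; apply: (@bounded_integrable _ _ _ P _ K) => //.
  exact: measurableT_comp.
have [iaY EaY] : P.-integrable setT (EFin \o (fun w => a (S w) * Y w)) /\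
    \int[P]_w (a (S w) * Y w) = \int[P]_w a (S w) * \int[P]_w Y w.
  apply: (@indep2_integrableM _ _ _ P (a \o S) Y) => //.
  - exact: measurableT_comp.
  - by apply: (@indep2_comp _ _ a id).
  - exact: iB.
have [ibY EbY] : P.-integrable setT (EFin \o (fun w => b (S w) * Y w ^+ 2)) /\
    \int[P]_w (b (S w) * Y w ^+ 2) = \int[P]_w b (S w) * \int[P]_w (Y w ^+ 2).
  apply: (@indep2_integrableM _ _ _ P (b \o S) (fun w => Y w ^+ 2)) => //.
  - exact: measurableT_comp.
  - exact: measurable_funX.
  - by apply: (@indep2_comp _ _ b (fun x => x ^+ 2)).
  - exact: iB.
rewrite EY mulr0 in EaY; rewrite EY2 in EbY.
have ifS := iB f mf bf; have ibS := iB b mb bb; have igS := iB _ mg bg.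
have ifYS : P.-integrable setT (EFin \o (fun w => f (Y w + S w))).
  apply: (@bounded_integrable _ _ _ P _ K) => //.
  by apply: measurableT_comp => //; exact: measurable_funD.
have iT : P.-integrable setT (EFin \o (fun w =>
    f (S w) + a (S w) * Y w + b (S w) * Y w ^+ 2)).
  exact: (integrableD measurableT (integrableD measurableT ifS iaY) ibY).
have ibs : P.-integrable setT (EFin \o (fun w => b (S w) * s ^+ 2)).
  exact: (integrableZr measurableT (s ^+ 2) ibS).
have irem : \int[P]_w taylor_rem f a b (S w) (Y w) =
    \int[P]_w f (Y w + S w) - \int[P]_w (f (S w) + b (S w) * s ^+ 2).
  rewrite /taylor_rem RintegralB//; last first.
    by apply: eq_integrable ifYS => // w _ /=; rewrite addrC.
  congr (_ - _); first by apply: eq_Rintegral => w _; rewrite addrC.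
  rewrite RintegralD//; last exact: (integrableD measurableT ifS iaY).
  by rewrite RintegralD// EaY addr0 EbY RintegralD// RintegralZr.
have ig : \int[P]_w (gauss_avg s f (S w) - (f (S w) + b (S w) * s ^+ 2)) =
    \int[P]_w gauss_avg s f (S w) - \int[P]_w (f (S w) + b (S w) * s ^+ 2).
  by rewrite RintegralB//; exact: (integrableD measurableT ifS ibs).
have -> : \int[P]_w f (Y w + S w) - \int[P]_w gauss_avg s f (S w) =
    \int[P]_w taylor_rem f a b (S w) (Y w) -
    \int[P]_w (gauss_avg s f (S w) - (f (S w) + b (S w) * s ^+ 2)).
  by rewrite irem ig; ring.
apply: (le_trans (ler_normB _ _)); apply: lerD.
  have it := integrable_trunc2 nu mY iY2.
  have ih : P.-integrable setT (EFin \o (fun w => nu * Y w ^+ 2)).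
    exact: (integrableZl measurableT nu iY2).
  have ihD := integrableD measurableT ih it.
  have -> : K * (nu * s ^+ 2 + trunc2 nu Y) = \int[P]_w
      (K * (nu * Y w ^+ 2 + Y w ^+ 2 * (nu < `|Y w|)%R%:R)).
    by rewrite RintegralZl// RintegralD// RintegralZl// EY2.
  apply: le_normr_Rintegral_dominated.
  - apply: measurable_funB.
      by apply: measurableT_comp => //; exact: measurable_funD.
    apply: measurable_funD; first apply: measurable_funD.
    + exact: measurableT_comp.
    + by apply: measurable_funM => //; exact: measurableT_comp.
    + by apply: measurable_funM; [exact: measurableT_comp|exact: measurable_funX].
  - exact: (integrableZl measurableT K ihD).
  - by move=> w; exact: taylor_rem_le.
apply: le_normr_Rintegral_bounded.
  apply: measurable_funB; first exact: measurableT_comp.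
  apply: measurable_funD; first exact: measurableT_comp.
  by apply: measurable_funM => //; exact: measurableT_comp.
by move=> w; exact: gauss_avg_expansion tf.
Qed.

(* The summands already replaced by Gaussian ones are absorbed in [t]. *)
Lemma lindeberg_replacement (I : eqType) (Y : I -> T -> R) (s : I -> R)
    (K : R) (f a b : R -> R) (nu : R) (J : seq I) (t : R) :
  mutually_independent P Y -> uniq J ->
  (forall j, 0 <= s j) ->
  (forall j, P.-integrable setT (EFin \o Y j)) ->
  (forall j, \int[P]_w Y j w = 0) ->
  (forall j, P.-integrable setT (EFin \o (fun w => Y j w ^+ 2))) ->
  (forall j, \int[P]_w (Y j w ^+ 2) = s j ^+ 2) ->
  0 <= nu -> taylor_class K f a b -> (forall x, 0 <= f x) -> 0 <= t ->
  `|\int[P]_w gauss_avg t f (\sum_(j <- J) Y j w)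
    - gauss_avg (Num.sqrt (t ^+ 2 + \sum_(j <- J) s j ^+ 2)) f 0| <=
  \sum_(j <- J) (K * (nu * s j ^+ 2 + trunc2 nu (Y j))
                 + K * normal_abs3 * s j ^+ 3).
Proof.
move=> indY uJ s0 iY EY iY2 EY2 nu0 tf f0.
have mY j : measurable_fun setT (Y j) by have [] := indY.
elim: J uJ t => [|j J IH] uJ t t0.
  rewrite !big_nil addr0 sqrtr_sqr (ger0_norm t0).
  under eq_Rintegral do rewrite big_nil.
  by rewrite (Rintegral_probability_cst P) subrr normr0.
have uJ' : uniq J by have /andP[] := uJ.
(* The next replacement acts on the already averaged function, which has the same constant [K]. *)
have tt := gauss_avg_taylor_class t tf.
rewrite !big_cons.
under eq_Rintegral do rewrite big_cons.
set t' := Num.sqrt (s j ^+ 2 + t ^+ 2).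
have t'2 : t' ^+ 2 = s j ^+ 2 + t ^+ 2 by rewrite sqr_sqrtr// addr_ge0 ?sqr_ge0.
have := IH uJ' t' (sqrtr_ge0 _).
rewrite t'2 (addrC (s j ^+ 2)) -addrA.
have SY : indep2 P (fun w => \sum_(i <- J) Y i w) (Y j).
  exact: mutually_independent_sum.
have mS : measurable_fun setT (fun w => \sum_(i <- J) Y i w).
  by apply: measurable_sum.
have := replacement_step nu0 (s0 j) tt mS (mY j) SY (iY j) (EY j) (iY2 j) (EY2 j).
have -> : \int[P]_w gauss_avg (s j) (gauss_avg t f) (\sum_(i <- J) Y i w) =
    \int[P]_w gauss_avg t' f (\sum_(i <- J) Y i w).
  by apply: eq_Rintegral => w _; exact: gauss_avg_semigroup tf f0.
set A := \int[P]_w _; set B := \int[P]_w _; set C := gauss_avg _ _ _.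
move=> h1 h2; have -> : A - C = (A - B) + (B - C) by ring.
by apply: (le_trans (ler_normD _ _)); exact: lerD.
Qed.

End lindeberg_replacement.

(** * From smoothed indicators to distribution functions *)

Section cvg_distribution.
Context d (T : measurableType d) (R : realType) (P : probability T R).
Local Notation N := (normal_prob (0 : R) (1 : R)).
Implicit Types x c r y : R.

Lemma Rintegral_probability_indic d' (T' : measurableType d')
  (Q : probability T' R) (A : set T') :
  measurable A -> \int[Q]_w \1_A w = fine (Q A).
Proof. by move=> mA; rewrite /Rintegral integral_indic// setIT. Qed.

Lemma normal_prob_itv_le x y : x <= y ->
  fine (N `]x, y]) <= normal_peak 1 * (y - x).
Proof.
move=> xy; have mp := measurable_normal_pdf (0 : R) 1.
have H : (N `]x, y] <= (normal_peak 1 * (y - x))%:E)%E.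
  rewrite /normal_prob.
  apply: (@le_trans _ _ (\int[lebesgue_measure]_(z in `]x, y]) (normal_peak 1)%:E)%E).
    apply: ge0_le_integral => //.
    - by move=> z _; rewrite lee_fin normal_pdf_ge0.
    - by apply/measurable_EFinP; exact: measurable_funTS.
    - by move=> z _; rewrite lee_fin normal_pdf_ub// oner_neq0.
  rewrite integral_cst//= lebesgue_measure_itv/= lte_fin.
  by case: ltP => h; rewrite ?mule0 ?lee_fin ?EFinM ?EFinB// mulr_ge0 ?normal_peak_ge0 ?subr_ge0.
rewrite -lee_fin fineK//; exact: fin_num_measure.
Qed.

(** The density is at most its peak. This Lipschitz bound pays for the transition zone of the
    smoothed indicators. *)
Lemma normal_cdf_le x y : x <= y ->
  fine (N `]-oo, y]) <= fine (N `]-oo, x]) + normal_peak 1 * (y - x).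
Proof.
move=> xy; apply: le_trans (lerD (lexx _) (normal_prob_itv_le xy)).
have AB0 : `]-oo, x] `&` `]x, y] = set0 :> set R.
  apply/seteqP; split => // z [] /=; rewrite !in_itv/= => zx /andP[xz _].
  by have := le_lt_trans zx xz; rewrite ltxx.
rewrite -fineD ?fin_num_measure// -(measureU N)//.
apply: fine_le; rewrite ?fin_num_measure//; first exact: measurableU.
apply: le_measure; rewrite ?inE//; first exact: measurableU.
move=> z /=; rewrite !in_itv/= => zy; have [zx|xz] := leP z x; first by left.
by right.
Qed.

Lemma measurable_step_affine r c : measurable_fun setT (fun z : R => step (r * (z - c))).
Proof.
have [ms _ _ _ _ _ _ _] := @step_taylor R.
apply: measurableT_comp => //; apply: measurable_funM => //.
exact: measurable_funB.
Qed.

(** The rescaled step is 1 up to c, 0 beyond c + 3 / r, and in between lies in [0, 1]. A general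
    probability [Q] is taken because the sandwich is used both under [P] and under the normal
    law. *)
Lemma step_affine_itv d' (T' : measurableType d') (Q : probability T' R)
    (Z : T' -> R) r c : 0 < r -> measurable_fun setT Z ->
  fine (Q (Z @^-1` `]-oo, c])) <= \int[Q]_w step (r * (Z w - c))
    <= fine (Q (Z @^-1` `]-oo, c + 3 / r])).
Proof.
move=> r0 mZ.
have mA y : measurable (Z @^-1` `]-oo, y]).
  by rewrite -[X in measurable X]setTI; exact: mZ.
have iA y : Q.-integrable setT (EFin \o \1_(Z @^-1` `]-oo, y])) by exact: integrable_indic.
have is_ : Q.-integrable setT (EFin \o (fun w => step (r * (Z w - c)))).
  apply: (@bounded_integrable _ _ _ Q _ 1).
    exact: measurableT_comp (measurable_step_affine r c) mZ.
  by move=> w; have := step_itv (r * (Z w - c)); rewrite ler_norml; lra.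
rewrite -!Rintegral_probability_indic//.
apply/andP; split; apply: le_Rintegral => // w _; rewrite indicE.
- have [|_] := boolP (w \in _); last by have /andP[] := step_itv (r * (Z w - c)).
  rewrite inE /= in_itv /= => Zc; rewrite step_le0//.
  by rewrite pmulr_rle0// subr_le0.
- have [_|] := boolP (w \in _); first by have /andP[] := step_itv (r * (Z w - c)).
  rewrite notin_setE /= in_itv /= => /negP; rewrite -ltNge => Zc.
  by rewrite step_ge3// -ler_pdivrMl// mulrC; lra.
Qed.

Lemma cvg_in_distribution_step (F : set_system R) (FF : Filter F) (Z : R -> T -> R) :
  (forall e, measurable_fun setT (Z e)) ->
  (forall r c, 0 < r -> \int[P]_w step (r * (Z e w - c)) @[e --> F] -->
     \int[N]_z step (r * (z - c))) ->
  cvg_in_distribution P F Z N.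
Proof.
move=> mZ HZ x _.
pose A e := Z e @^-1` `]-oo, x].
have mA e : measurable (A e) by rewrite -[X in measurable X]setTI; exact: mZ.
rewrite (_ : (fun e => P (Z e @^-1` `]-oo, x])) = (fun e => (fine (P (A e)))%:E)); last first.
  by apply/funext => e; rewrite fineK// fin_num_measure.
rewrite -[X in _ --> X]fineK; last exact: fin_num_measure.
apply: cvg_EFin; first exact: nearW.
apply/cvgrPdist_le => eps eps0.
have p0 : 0 < normal_peak (1 : R) by rewrite normal_peak_gt0// oner_neq0.
(* Chosen so that the normal mass of a transition zone, of length 3 / r, is at most eps / 2. *)
pose r := 6 * normal_peak 1 / eps.
have r0 : 0 < r by rewrite divr_gt0// mulr_gt0.
have e2 : 0 < eps / 2 by rewrite divr_gt0.
have d0 : 0 <= 3 / r by rewrite divr_ge0// ltW.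
have pd : normal_peak 1 * (3 / r) = eps / 2.
  by rewrite /r; field; rewrite !gt_eqF.
(* The step starting at x bounds the distribution function at x from above; the one ending at x
   bounds it from below. *)
have /cvgrPdist_le /(_ _ e2) H1 := HZ r x r0.
have /cvgrPdist_le /(_ _ e2) H2 := HZ r (x - 3 / r) r0.
have midN : measurable_fun setT (@idfun R) by exact: measurable_id.
have E1 : x - 3 / r + 3 / r = x by ring.
have E2 : x + 3 / r - x = 3 / r by ring.
have E3 : x - (x - 3 / r) = 3 / r by ring.
near=> e.
have := step_affine_itv P x r0 (mZ e).
have := step_affine_itv P (x - 3 / r) r0 (mZ e).
have := step_affine_itv N x r0 midN.
have := step_affine_itv N (x - 3 / r) r0 midN.
have l1 : x <= x + 3 / r by rewrite lerDl.
have l2 : x - 3 / r <= x by rewrite gerBl.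
have := normal_cdf_le l1; have := normal_cdf_le l2.
rewrite E1 E2 E3 pd /idfun /=.
have : `|\int[N]_z step (r * (z - x)) - \int[P]_w step (r * (Z e w - x))| <= eps / 2.
  by near: e.
have : `|\int[N]_z step (r * (z - (x - 3 / r)))
    - \int[P]_w step (r * (Z e w - (x - 3 / r)))| <= eps / 2.
  by near: e.
rewrite !ler_norml -/(A e) => /andP[? ?] /andP[? ?] ? ? /andP[? ?] /andP[? ?].
move=> /andP[? ?] /andP[? ?]; apply/andP; split; lra.
Unshelve. all: by end_near. Qed.

End cvg_distribution.

(** * Lindeberg's theorem for arrays indexed along a filter *)

Section lindeberg_clt.
Context d (T : measurableType d) (R : realType) (P : probability T R).

Lemma lindeberg_clt (I : eqType) (F : set_system R) (FF : Filter F)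
    (J : R -> seq I) (Y : R -> I -> T -> R) (s : R -> I -> R) :
  (forall e, mutually_independent P (Y e)) -> (forall e, uniq (J e)) ->
  (forall e j, 0 <= s e j) ->
  (forall e j, P.-integrable setT (EFin \o Y e j)) ->
  (forall e j, \int[P]_w Y e j w = 0) ->
  (forall e j, P.-integrable setT (EFin \o (fun w => Y e j w ^+ 2))) ->
  (forall e j, \int[P]_w (Y e j w ^+ 2) = s e j ^+ 2) ->
  (forall e, \sum_(j <- J e) s e j ^+ 2 = 1) ->
  (forall nu, 0 < nu -> \forall e \near F, forall j, j \in J e -> s e j <= nu) ->
  (forall nu, 0 < nu ->
     \sum_(j <- J e) trunc2 P nu (Y e j) @[e --> F] --> 0) ->
  cvg_in_distribution P F (fun e w => \sum_(j <- J e) Y e j w)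
    (normal_prob 0 1).
Proof.
move=> indY uJ s0 iY EY iY2 EY2 s1 sup_s trunc0.
have mY e j : measurable_fun setT (Y e j) by have [] := indY e.
apply: cvg_in_distribution_step => [e|r c r0]; first exact: measurable_sum.
have tf := taylor_class_affine c (ltW r0) (@step_taylor R).
set K := 10 * (1 + r) ^+ 3 in tf.
have K0 : 0 < K by rewrite mulr_gt0// exprn_gt0//; lra.
have M30 : 0 <= normal_abs3 :> R by apply: Rintegral_ge0 => z _; rewrite exprn_ge0.
set M3 : R := normal_abs3 in M30.
have f0 x : 0 <= step (r * (x - c)) by have /andP[] := step_itv (r * (x - c)).
apply/cvgrPdist_le => eps eps0.
(* One [nu] serves as truncation level and as bound for the s_j. As the s_j^2 add up to 1 and s_j^3
   <= nu s_j^2, everything except the truncated moments costs K nu (1 + M3) = eps / 3. *)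
pose nu := eps / (3 * K * (1 + M3)).
have M31 : 0 < 1 + M3 by lra.
have nu0 : 0 < nu by rewrite divr_gt0// mulr_gt0// mulr_gt0.
have eK0 : 0 < eps / (3 * K) by rewrite divr_gt0// mulr_gt0.
have /cvgrPdist_le /(_ _ eK0) Htr := trunc0 _ nu0.
have Hsup := sup_s _ nu0.
near=> e.
have tr : `|0 - \sum_(j <- J e) trunc2 P nu (Y e j)| <= eps / (3 * K) by near: e.
have sup : forall j, j \in J e -> s e j <= nu by near: e.
have := lindeberg_replacement (indY e) (uJ e) (s0 e) (iY e) (EY e) (iY2 e)
  (EY2 e) (ltW nu0) tf f0 (lexx 0).
rewrite s1 expr0n add0r sqrtr1.
under eq_Rintegral do rewrite gauss_avg0.
have -> : gauss_avg 1 (fun x => step (r * (x - c))) 0 =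
    \int[normal_prob (0 : R) (1 : R)]_z step (r * (z - c)).
  by apply: eq_Rintegral => z _; rewrite add0r mul1r.
rewrite distrC => /le_trans; apply.
apply: (@le_trans _ _ (\sum_(j <- J e) (K * nu * s e j ^+ 2
  + K * trunc2 P nu (Y e j) + K * M3 * nu * s e j ^+ 2))).
  rewrite big_seq [leRHS]big_seq; apply: ler_sum => j jJ.
  have h : s e j ^+ 3 <= nu * s e j ^+ 2.
    by rewrite exprS ler_wpM2r ?sqr_ge0// sup.
  rewrite mulrDr mulrA lerD2l -[leRHS]mulrA ler_wpM2l//.
  by rewrite mulr_ge0// ltW.
rewrite !big_split/= -!mulr_sumr s1 !mulr1.
have tr' : K * \sum_(j <- J e) trunc2 P nu (Y e j) <= eps / 3.
  rewrite -ler_pdivlMl//; apply: (le_trans (ler_norm _)).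
  rewrite sub0r normrN in tr; apply: (le_trans tr).
  by rewrite le_eqVlt; apply/orP; left; apply/eqP; field; rewrite gt_eqF.
have -> : K * nu + K * \sum_(j <- J e) trunc2 P nu (Y e j) + K * M3 * nu =
  K * nu * (1 + M3) + K * \sum_(j <- J e) trunc2 P nu (Y e j) by ring.
have -> : K * nu * (1 + M3) = eps / 3 by rewrite /nu; field; rewrite !gt_eqF.
by lra.
Unshelve. all: by end_near. Qed.

End lindeberg_clt.

(** * Asymptotics of the sample numbers and of the estimator variance *)

Section mlmc_asymptotics.
Context {R : realType}.
Implicit Types (y e : R) (l k n : nat).

(** Deterministic counterpart of [Sk], with a bare sequence of variances, as [samples] is of [Meps];
    both unfold to the originals at [Vl P Xs]. *)
Definition level_sum (v C : nat -> R) k : R :=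
  \sum_(l < k.+1) Num.sqrt (v l * C l).

(** For y >= 0 the lower limit 1, like the ceiling, exceeds y by at most 1; for y < 0 the upper
    bound would fail when y is small. *)
Lemma absz_max_ceil y (n := `|Num.max (Num.ceil y) 1%Z|%N) :
  [/\ y <= n%:R, (0 < n)%N & 0 <= y -> n%:R <= y + 1 :> R].
Proof.
have n1 : (1 <= Num.max (Num.ceil y) 1)%R by rewrite le_max lexx orbT.
have nE : n%:R = (Num.max (Num.ceil y) 1%Z)%:~R :> R.
  by rewrite /n natr_absz ger0_norm// (le_trans _ n1).
split.
- rewrite nE (le_trans (ceil_ge y))// ler_int le_max lexx//.
- by rewrite /n absz_gt0 gt_eqF// (lt_le_trans _ n1).
- move=> y0; rewrite nE; have [h|h] := leP (Num.ceil y) 1%Z.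
    by rewrite lerDr.
  have := ceilB1_lt y; rewrite intrB; lra.
Qed.

Definition samples (v C : nat -> R) (alpha calpha e : R) l : nat :=
  `|Num.max (Num.ceil (e ^- 2 * Num.sqrt (v l / C l)
       * level_sum v C (Leps alpha calpha e))) 1%Z|%N.

Definition mlmc_var (v C : nat -> R) (alpha calpha e : R) : R :=
  \sum_(l < (Leps alpha calpha e).+1) v l / (samples v C alpha calpha e l)%:R.

Variables (v C : nat -> R) (alpha gamma calpha C' : R).
Hypotheses (v_ge0 : forall l, 0 <= v l) (v0_gt0 : 0 < v 0%N).
Hypotheses (C_gt0 : forall l, 0 < C l).
Hypothesis C_le : forall l, C l <= C' * expR (gamma * l%:R).
Hypotheses (alpha_gt0 : 0 < alpha) (gamma_gt0 : 0 < gamma)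
  (calpha_gt0 : 0 < calpha).
Local Notation S := (level_sum v C).
Local Notation L := (Leps alpha calpha).
Local Notation M := (samples v C alpha calpha).
Local Notation var := (mlmc_var v C alpha calpha).
Hypothesis level_sum_cvg :
  (expR ((2 * alpha - gamma) * k%:R) * S k ^+ 2) @[k --> \oo] --> +oo.

Let C'_gt0 : 0 < C'.
Proof. by have := lt_le_trans (C_gt0 0) (C_le 0); rewrite mulr0 expR0 mulr1. Qed.

Lemma level_sum_gt0 k : 0 < S k.
Proof.
rewrite /level_sum big_ord_recl ltr_pwDl ?sqrtr_gt0 ?mulr_gt0//.
exact: sumr_ge0.
Qed.

Lemma level_sum_le l k : (l <= k)%N -> S l <= S k.
Proof.
move=> lk; rewrite /level_sum -(subnKC lk) -addSn.
rewrite -!(big_mkord xpredT (fun i => Num.sqrt (v i * C i))).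
rewrite (@big_cat_nat _ _ _ l.+1 0 (l.+1 + (k - l)))//= ?leq_addr// lerDl.
exact: sumr_ge0.
Qed.

Lemma samples_gt0 e l : 0 < (M e l)%:R :> R.
Proof. by rewrite ltr0n; have [] := absz_max_ceil (e ^- 2 * Num.sqrt (v l / C l) * S (L e)). Qed.

Lemma mlmc_var_gt0 e : 0 < var e.
Proof.
rewrite /mlmc_var big_ord_recl ltr_pwDl ?divr_gt0 ?samples_gt0//.
by apply: sumr_ge0 => i _; rewrite divr_ge0// ltW// samples_gt0.
Qed.

Lemma Leps_cvg n : \forall e \near (0 : R)^'+, (n <= L e)%N.
Proof.
near=> e.
have e0 : 0 < e by near: e; exact: nbhs_right_gt.
have [h _ _] := absz_max_ceil (ln (calpha / e) / alpha).
rewrite -(ler_nat R); apply: le_trans h.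
rewrite ler_pdivlMr// -[leLHS]expRK ler_ln ?posrE ?expR_gt0 ?divr_gt0//.
rewrite ler_pdivlMr// mulrC -ler_pdivlMr ?expR_gt0//.
by near: e; apply: nbhs_right_le; rewrite divr_gt0 ?expR_gt0.
Unshelve. all: by end_near. Qed.

(** Once eps <= calpha the logarithm is nonnegative, so rounding adds at most 1 to the level; this
    is the factor e^alpha. *)
Lemma Leps_expR :
  \forall e \near (0 : R)^'+, e * expR (alpha * (L e)%:R) <= calpha * expR alpha.
Proof.
near=> e.
have e0 : 0 < e by near: e; exact: nbhs_right_gt.
have e1 : e <= calpha by near: e; exact: nbhs_right_le.
have ln0 : 0 <= ln (calpha / e) by rewrite ln_ge0// ler_pdivlMr// mul1r.
have [_ _ h] := absz_max_ceil (ln (calpha / e) / alpha).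
have {}h := h (divr_ge0 ln0 (ltW alpha_gt0)).
have {}h : alpha * (L e)%:R <= ln (calpha / e) + alpha.
  apply: (le_trans (ler_wpM2l (ltW alpha_gt0) h)).
  by rewrite mulrDr mulr1 mulrC divfK// gt_eqF.
have := h; rewrite -ler_expR expRD lnK ?posrE ?divr_gt0// => {}h.
apply: (le_trans (ler_wpM2l (ltW e0) h)).
by rewrite mulrA (mulrC calpha) mulVKf// gt_eqF.
Unshelve. all: by end_near. Qed.

Let B := calpha * expR alpha.

Let B_gt0 : 0 < B. Proof. by rewrite mulr_gt0// expR_gt0. Qed.

Lemma sq_eps_le e : 0 <= e -> e * expR (alpha * (L e)%:R) <= B ->
  e ^+ 2 <= B ^+ 2 * expR (- (2 * alpha * (L e)%:R)).
Proof.
move=> e0 he; have -> : 2 * alpha * (L e)%:R = alpha * (L e)%:R + alpha * (L e)%:R.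
  by ring.
rewrite expRN expRD ler_pdivlMr ?mulr_gt0 ?expR_gt0//.
have -> : e ^+ 2 * (expR (alpha * (L e)%:R) * expR (alpha * (L e)%:R)) =
  (e * expR (alpha * (L e)%:R)) ^+ 2 by ring.
by rewrite lerXn2r// nnegrE ?mulr_ge0 ?expR_ge0// ltW.
Qed.

(** With eps^2 <= B^2 e^(-2 alpha L) the left side is at most C' B^2 / K_L, and L tends to
    infinity. *)
Lemma cost_ratio_cvg0 delta : 0 < delta -> \forall e \near (0 : R)^'+,
  e ^+ 2 * (C' * expR (gamma * (L e)%:R)) / S (L e) ^+ 2 <= delta.
Proof.
move=> d0; have /cvgryPge /(_ (C' * B ^+ 2 / delta)) [n _ Hn] := level_sum_cvg.
near=> e.
have e0 : 0 < e by near: e; exact: nbhs_right_gt.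
have he : e * expR (alpha * (L e)%:R) <= B by near: e; exact: Leps_expR.
have hL : (n <= L e)%N by near: e; exact: Leps_cvg.
have SL := level_sum_gt0 (L e).
have := Hn (L e) hL; rewrite /= ler_pdivrMr// => HK.
rewrite ler_pdivrMr ?exprn_gt0//.
apply: (@le_trans _ _ (B ^+ 2 * expR (- (2 * alpha * (L e)%:R)) *
    (C' * expR (gamma * (L e)%:R)))).
  by rewrite ler_wpM2r ?mulr_ge0 ?expR_ge0 ?(ltW C'_gt0)// sq_eps_le// ltW.
have -> : B ^+ 2 * expR (- (2 * alpha * (L e)%:R)) * (C' * expR (gamma * (L e)%:R))
  = C' * B ^+ 2 * expR (- ((2 * alpha - gamma) * (L e)%:R)).
  have -> : - ((2 * alpha - gamma) * (L e)%:R) =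
    - (2 * alpha * (L e)%:R) + gamma * (L e)%:R by ring.
  by rewrite expRD; ring.
by rewrite expRN ler_pdivrMr ?expR_gt0// (le_trans HK)// le_eqVlt; apply/orP; left; apply/eqP; ring.
Unshelve. all: by end_near. Qed.

Lemma sum_expR_le k : \sum_(l < k.+1) expR (gamma * l%:R) <=
  expR (gamma * k%:R) * (expR gamma / (expR gamma - 1)).
Proof.
have g1 : 1 < expR gamma by rewrite expR_gt1.
have g0 : 0 < expR gamma - 1 by rewrite subr_gt0.
elim: k => [|k IH].
  rewrite big_ord_recl big_ord0 addr0 mulr0 expR0 mul1r ler_pdivlMr//; lra.
rewrite big_ord_recr/=; apply: (le_trans (lerD IH (lexx _))).
have -> : gamma * k.+1%:R = gamma * k%:R + gamma by rewrite -natr1; ring.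
(* The constant q = e^gamma / (e^gamma - 1) satisfies q + e^gamma = q e^gamma, so the induction
   closes with equality. *)
rewrite expRD le_eqVlt; apply/orP; left; apply/eqP; field.
by rewrite gt_eqF.
Qed.

(* From [v / (x + 1) >= v / x - v / x ^+ 2] at the unrounded sample number [x]. *)
Lemma sample_var_lower e l : 0 < e ->
  e ^+ 2 * Num.sqrt (v l * C l) / S (L e) - e ^+ 4 * C l / S (L e) ^+ 2
    <= v l / (M e l)%:R.
Proof.
move=> e0; have SL := level_sum_gt0 (L e); have Cl := C_gt0 l.
have M0 := samples_gt0 e l.
have [v0|vl0] := eqVneq (v l) 0.
  rewrite v0 !mul0r sqrtr0 mulr0 mul0r sub0r oppr_le0 divr_ge0 ?sqr_ge0//.
  by rewrite mulr_ge0 ?exprn_ge0// ltW.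
have vl : 0 < v l by rewrite lt_neqAle eq_sym vl0 v_ge0.
have [_ _] := absz_max_ceil (e ^- 2 * Num.sqrt (v l / C l) * S (L e)).
set x := e ^- 2 * _ * _; rewrite -/(M e l).
have s0 : 0 < Num.sqrt (v l / C l) by rewrite sqrtr_gt0 divr_gt0.
have x0 : 0 < x by rewrite !mulr_gt0// invr_gt0 exprn_gt0.
move=> /(_ (ltW x0)) Mx.
apply: (@le_trans _ _ (v l / (x + 1))); last first.
  by rewrite ler_wpM2l// lef_pV2 ?posrE//; lra.
have sE : Num.sqrt (v l * C l) = Num.sqrt (v l / C l) * C l.
  apply: (@pexpIrn _ 2) => //; rewrite ?nnegrE ?mulr_ge0// ?ltW//.
  by rewrite exprMn !sqr_sqrtr ?divr_ge0 ?mulr_ge0 ?(ltW vl) ?(ltW Cl)//; field; rewrite gt_eqF.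
have vE : v l = Num.sqrt (v l / C l) ^+ 2 * C l.
  by rewrite sqr_sqrtr ?divr_ge0 ?(ltW vl) ?(ltW Cl)// divfK// gt_eqF.
have -> : e ^+ 2 * Num.sqrt (v l * C l) / S (L e) = v l / x.
  rewrite sE [in RHS]vE /x; field.
  by rewrite !gt_eqF.
have -> : e ^+ 4 * C l / S (L e) ^+ 2 = v l / x ^+ 2.
  rewrite [in RHS]vE /x; field.
  by rewrite !gt_eqF.
rewrite -mulrBr ler_wpM2l//.
rewrite -subr_ge0.
have -> : (x + 1)^-1 - (x^-1 - (x ^+ 2)^-1) = (x ^+ 2 * (x + 1))^-1.
  by field; rewrite !gt_eqF//; lra.
by rewrite invr_ge0 mulr_ge0 ?sqr_ge0//; lra.
Qed.

Lemma mlmc_var_lower : \forall e \near (0 : R)^'+, e ^+ 2 / 2 <= var e.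
Proof.
have g0 : 0 < expR gamma - 1 by rewrite subr_gt0 expR_gt1.
pose k := expR gamma / (expR gamma - 1).
have k0 : 0 < k by rewrite divr_gt0 ?expR_gt0.
(* The costs up to level L add up to at most k C' e^(gamma L), so this threshold caps the rounding
   loss at eps^2 / 2. *)
have d0 : 0 < (2 * k)^-1 by rewrite invr_gt0 mulr_gt0.
near=> e.
have e0 : 0 < e by near: e; exact: nbhs_right_gt.
have hr : e ^+ 2 * (C' * expR (gamma * (L e)%:R)) / S (L e) ^+ 2 <= (2 * k)^-1.
  by near: e; exact: cost_ratio_cvg0.
have SL := level_sum_gt0 (L e).
rewrite /mlmc_var.
apply: (@le_trans _ _ (\sum_(l < (L e).+1)
  (e ^+ 2 * Num.sqrt (v l * C l) / S (L e) - e ^+ 4 * C l / S (L e) ^+ 2))).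
2: by apply: ler_sum => l _; exact: sample_var_lower.
rewrite sumrB -!mulr_suml -!mulr_sumr -/(S (L e)) mulfK ?gt_eqF//.
have sC : \sum_(l < (L e).+1) C l <= C' * (expR (gamma * (L e)%:R) * k).
  apply: (@le_trans _ _ (\sum_(l < (L e).+1) (C' * expR (gamma * l%:R)))).
    by apply: ler_sum => l _; exact: C_le.
  by rewrite -mulr_sumr ler_wpM2l ?sum_expR_le// ltW.
suff : e ^+ 4 * (\sum_(l < (L e).+1) C l) / S (L e) ^+ 2 <= e ^+ 2 / 2 by lra.
apply: (@le_trans _ _ (e ^+ 2 * k *
  (e ^+ 2 * (C' * expR (gamma * (L e)%:R)) / S (L e) ^+ 2))).
  have -> : e ^+ 2 * k * (e ^+ 2 * (C' * expR (gamma * (L e)%:R)) / S (L e) ^+ 2)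
    = e ^+ 4 * (C' * (expR (gamma * (L e)%:R) * k)) / S (L e) ^+ 2 by ring.
  by rewrite ler_wpM2r ?invr_ge0 ?sqr_ge0// ler_wpM2l// exprn_ge0// ltW.
apply: (le_trans (ler_wpM2l _ hr)).
  by rewrite mulr_ge0 ?sqr_ge0// ltW.
by rewrite le_eqVlt; apply/orP; left; apply/eqP; field; rewrite gt_eqF.
Unshelve. all: by end_near. Qed.

(** M_l is at least the unrounded sample number and the variance at least eps^2 / 2; v_l then
    cancels. The denominator is cleared first, with M_l and the variance positive. *)
Lemma sample_ratio_lower e l : 0 < e -> e ^+ 2 / 2 <= var e ->
  v l / ((M e l)%:R ^+ 2 * var e) <= 2 * (e ^+ 2 * C l / S (L e) ^+ 2).
Proof.
move=> e0 he; have SL := level_sum_gt0 (L e); have Cl := C_gt0 l.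
have M0 := samples_gt0 e l; have V0 := mlmc_var_gt0 e.
rewrite ler_pdivrMr ?mulr_gt0 ?exprn_gt0//.
have [Mx _ _] := absz_max_ceil (e ^- 2 * Num.sqrt (v l / C l) * S (L e)).
rewrite -/(M e l) in Mx.
have x0 : 0 <= e ^- 2 * Num.sqrt (v l / C l) * S (L e).
  by rewrite !mulr_ge0 ?invr_ge0 ?sqr_ge0// ltW.
have M2 : (e ^- 2 * Num.sqrt (v l / C l) * S (L e)) ^+ 2 <= (M e l)%:R ^+ 2.
  by rewrite lerXn2r// nnegrE ltW.
have {}M2 : e ^- 4 * (v l / C l) * S (L e) ^+ 2 <= (M e l)%:R ^+ 2.
  apply: le_trans M2; rewrite !exprMn sqr_sqrtr ?divr_ge0 ?(ltW Cl)//.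
  by rewrite exprVn -exprM.
apply: (@le_trans _ _ (2 * (e ^+ 2 * C l / S (L e) ^+ 2) *
   (e ^- 4 * (v l / C l) * S (L e) ^+ 2 * (e ^+ 2 / 2)))).
  rewrite le_eqVlt; apply/orP; left; apply/eqP; field.
  by rewrite !gt_eqF.
apply: ler_wpM2l.
  by rewrite mulr_ge0// divr_ge0 ?sqr_ge0// mulr_ge0 ?sqr_ge0// ltW.
apply: ler_pM => //; last by rewrite divr_ge0 ?sqr_ge0.
rewrite mulr_ge0 ?sqr_ge0// mulr_ge0 ?divr_ge0 ?(ltW Cl)//.
by rewrite invr_ge0 exprn_ge0// ltW.
Qed.

(** Uniformity in l comes from bounding C_l by the cost bound at the top level L. *)
Lemma sample_ratio_cvg0 delta : 0 < delta -> \forall e \near (0 : R)^'+,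
  forall l, (l <= L e)%N -> v l / ((M e l)%:R ^+ 2 * var e) <= delta.
Proof.
move=> d0; have d2 : 0 < delta / 2 by rewrite divr_gt0.
near=> e => l lL.
have e0 : 0 < e by near: e; exact: nbhs_right_gt.
have he : e ^+ 2 / 2 <= var e by near: e; exact: mlmc_var_lower.
have hr : e ^+ 2 * (C' * expR (gamma * (L e)%:R)) / S (L e) ^+ 2 <= delta / 2.
  by near: e; exact: cost_ratio_cvg0.
have SL := level_sum_gt0 (L e).
apply: (le_trans (sample_ratio_lower l e0 he)).
suff : e ^+ 2 * C l / S (L e) ^+ 2 <=
    e ^+ 2 * (C' * expR (gamma * (L e)%:R)) / S (L e) ^+ 2 by lra.
rewrite ler_wpM2r ?invr_ge0 ?sqr_ge0// ler_wpM2l ?sqr_ge0//.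
apply: (le_trans (C_le l)); rewrite ler_wpM2l ?(ltW C'_gt0)// ler_expR.
by rewrite ler_wpM2l ?(ltW gamma_gt0)// ler_nat.
Unshelve. all: by end_near. Qed.

(** Here the cost stays at level l, while e^(-2 alpha L) and 1 / S_L^2 are increased to their values
    at l, giving a bound in K_l free of eps. *)
Lemma sample_ratio_le : \forall e \near (0 : R)^'+, forall l, (l <= L e)%N ->
  v l / ((M e l)%:R ^+ 2 * var e) <=
  2 * C' * B ^+ 2 / (expR ((2 * alpha - gamma) * l%:R) * S l ^+ 2).
Proof.
near=> e => l lL.
have e0 : 0 < e by near: e; exact: nbhs_right_gt.
have he : e ^+ 2 / 2 <= var e by near: e; exact: mlmc_var_lower.
have hB : e * expR (alpha * (L e)%:R) <= B by near: e; exact: Leps_expR.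
have Sl := level_sum_gt0 l; have SL := level_sum_gt0 (L e).
apply: (le_trans (sample_ratio_lower l e0 he)).
have -> : 2 * C' * B ^+ 2 / (expR ((2 * alpha - gamma) * l%:R) * S l ^+ 2) =
  2 * (B ^+ 2 * expR (- (2 * alpha * l%:R)) * (C' * expR (gamma * l%:R)) / S l ^+ 2).
  have -> : (2 * alpha - gamma) * l%:R = 2 * alpha * l%:R - gamma * l%:R by ring.
  rewrite expRD !expRN; field.
  by rewrite !gt_eqF ?expR_gt0.
rewrite ler_wpM2l// ler_pM ?mulr_ge0 ?invr_ge0 ?sqr_ge0 ?(ltW (C_gt0 l))//.
  rewrite ler_pM ?sqr_ge0 ?(ltW (C_gt0 l))//.
  apply: (le_trans (sq_eps_le (ltW e0) hB)).
  rewrite ler_wpM2l ?sqr_ge0// ler_expR lerN2.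
  by rewrite ler_wpM2l ?mulr_ge0 ?(ltW alpha_gt0)// ler_nat.
by rewrite lef_pV2 ?posrE ?exprn_gt0// lerXn2r ?nnegrE ?(ltW Sl) ?(ltW SL)// level_sum_le.
Unshelve. all: by end_near. Qed.

End mlmc_asymptotics.

(** * Moments, tails and the normalized estimator *)

Section centered_moments.
Context d (T : measurableType d) (R : realType) (P : probability T R).
Implicit Types X Y Z : T -> R.

Lemma indic_boolE (b : T -> bool) w : \1_[set w' | b w'] w = (b w)%:R :> R.
Proof.
rewrite indicE; congr (nat_of_bool _)%:R.
by apply/idP/idP; rewrite inE.
Qed.

Lemma Lfun2_measurable Z : Z \in Lfun P 2%:E -> measurable_fun setT Z.
Proof. by rewrite inE => /andP[+ _]; rewrite inE. Qed.

Lemma Lfun2_integrable Z : Z \in Lfun P 2%:E -> P.-integrable setT (EFin \o Z).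
Proof.
move=> Z2; apply/Lfun1_integrable; apply: Lfun_subset12 => //.
exact: fin_num_measure.
Qed.

Lemma Lfun2_centered Z (m := fine ('E_P[Z])) : Z \in Lfun P 2%:E ->
  [/\ P.-integrable setT (EFin \o (fun w => Z w - m)),
      \int[P]_w (Z w - m) = 0,
      P.-integrable setT (EFin \o (fun w => (Z w - m) ^+ 2)) &
      \int[P]_w (Z w - m) ^+ 2 = fine ('V_P[Z])].
Proof.
move=> Z2; have iZ := Lfun2_integrable Z2.
have im := finite_measure_integrable_cst P m measurableT.
have mE : m = \int[P]_w Z w by rewrite /m unlock.
split.
- exact: (integrableB measurableT iZ im).
- by rewrite RintegralB// Rintegral_probability_cst -mE subrr.
- have iZ2 := Lfun2_integrable_sqr Z2.
  have iZm := integrableZl measurableT (- (2 * m)) iZ.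
  have im2 := finite_measure_integrable_cst P (m ^+ 2) measurableT.
  apply: eq_integrable (integrableD measurableT (integrableD measurableT iZ2 iZm) im2) => //.
  by move=> w _ /=; congr EFin; ring.
- rewrite /variance covariance.unlock -/m expectation.unlock.
  by congr fine; apply: eq_integral => w _; rewrite expr2.
Qed.

Lemma variance_shift Y (c : R) : measurable_fun setT Y ->
  P.-integrable setT (EFin \o Y) -> \int[P]_w Y w = 0 ->
  fine ('V_P[fun w => Y w + c]) = \int[P]_w (Y w ^+ 2).
Proof.
move=> mY iY EY; rewrite /variance covariance.unlock.
have -> : fine ('E_P[fun w => Y w + c]) = c.
  rewrite unlock; transitivity (\int[P]_w (Y w + c)) => //.
  rewrite RintegralD//; last exact: finite_measure_integrable_cst.
  by rewrite EY add0r Rintegral_probability_cst.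
rewrite expectation.unlock.
by congr fine; apply: eq_integral => w _; rewrite !fctE /= addrK expr2.
Qed.

Lemma same_law_ge0_integral Y Z (f : R -> \bar R) : measurable_fun setT Y ->
  measurable_fun setT Z -> same_law P Y Z -> measurable_fun setT f ->
  (forall x, 0 <= f x)%E -> (\int[P]_w f (Y w) = \int[P]_w f (Z w))%E.
Proof.
move=> mY mZ YZ mf f0.
pose rY : {RV P >-> R} := mfun_Sub (mem_set mY).
pose rZ : {RV P >-> R} := mfun_Sub (mem_set mZ).
have := ge0_integral_distribution rY mf f0.
have := ge0_integral_distribution rZ mf f0.
rewrite (eq_measure_integral (distribution P rY)); last first.
  by move=> A mA _; apply/esym; exact: YZ.
by move=> h1 h2; rewrite -[LHS]h2 -[RHS]h1.
Qed.

Lemma same_law_integrable Y Z (f : R -> R) : measurable_fun setT Y ->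
  measurable_fun setT Z -> same_law P Y Z -> measurable_fun setT f ->
  P.-integrable setT (EFin \o (f \o Z)) ->
  P.-integrable setT (EFin \o (f \o Y)) /\
  \int[P]_w f (Y w) = \int[P]_w f (Z w).
Proof.
move=> mY mZ YZ mf /integrableP[_ iZ].
have mEf : measurable_fun setT (EFin \o f) by exact/measurable_EFinP.
split.
  apply/integrableP; split; first by apply/measurable_EFinP; exact: measurableT_comp.
  have /= -> := same_law_ge0_integral mY mZ YZ
    (measurableT_comp (@abse_measurable _ setT) mEf) (fun x => abse_ge0 _).
  exact: iZ.
rewrite /Rintegral integralE [in RHS]integralE; congr (fine (_ - _)%E).
- transitivity (\int[P]_w ((EFin \o f)^\+ (Y w)))%E.
    by apply: eq_integral => w _; rewrite !funeposE.
  rewrite (same_law_ge0_integral mY mZ YZ (measurable_funepos mEf))//.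
  by apply: eq_integral => w _; rewrite !funeposE.
- transitivity (\int[P]_w ((EFin \o f)^\- (Y w)))%E.
    by apply: eq_integral => w _; rewrite !funenegE.
  rewrite (same_law_ge0_integral mY mZ YZ (measurable_funeneg mEf))//.
  by apply: eq_integral => w _; rewrite !funenegE.
Qed.

(** Cross terms vanish by independence and centring. Integrability is carried along the induction
    because the product lemma needs it for the partial sum. *)
Lemma independent_sum_sqr (I : eqType) (Y : I -> T -> R) (J : seq I) :
  mutually_independent P Y -> uniq J ->
  (forall j, P.-integrable setT (EFin \o Y j)) ->
  (forall j, \int[P]_w Y j w = 0) ->
  (forall j, P.-integrable setT (EFin \o (fun w => Y j w ^+ 2))) ->
  [/\ P.-integrable setT (EFin \o (fun w => \sum_(j <- J) Y j w)),
    \int[P]_w (\sum_(j <- J) Y j w) = 0,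
    P.-integrable setT (EFin \o (fun w => (\sum_(j <- J) Y j w) ^+ 2)) &
    \int[P]_w ((\sum_(j <- J) Y j w) ^+ 2) = \sum_(j <- J) \int[P]_w (Y j w ^+ 2)].
Proof.
move=> indY uJ iY EY iY2.
have mY j : measurable_fun setT (Y j) by have [] := indY.
elim: J uJ => [|j J IH] uJ.
  have i0 := finite_measure_integrable_cst P 0 measurableT.
  split.
  - by apply: eq_integrable i0 => // w _ /=; rewrite big_nil.
  - by under eq_Rintegral do rewrite big_nil; rewrite Rintegral_probability_cst.
  - by apply: eq_integrable i0 => // w _ /=; rewrite big_nil expr0n.
  - under eq_Rintegral do rewrite big_nil expr0n.
    by rewrite big_nil Rintegral_probability_cst.
have [|iS ES iS2 ES2] := IH; first by have /andP[] := uJ.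
have SY := mutually_independent_sum indY uJ.
have mS : measurable_fun setT (fun w => \sum_(i <- J) Y i w) by exact: measurable_sum.
have [iSY ESY] := indep2_integrableM mS (mY j) SY iS (iY j).
rewrite ES mul0r in ESY.
have i2SY : P.-integrable setT (EFin \o (fun w => 2 * ((\sum_(i <- J) Y i w) * Y j w))).
  exact: (integrableZl measurableT 2 iSY).
have sqE w : (\sum_(i <- j :: J) Y i w) ^+ 2 =
    Y j w ^+ 2 + 2 * ((\sum_(i <- J) Y i w) * Y j w) + (\sum_(i <- J) Y i w) ^+ 2.
  by rewrite big_cons; ring.
have iD := integrableD measurableT (iY2 j) i2SY.
split.
- apply: eq_integrable (integrableD measurableT (iY j) iS) => // w _ /=.
  by rewrite big_cons.
- under eq_Rintegral do rewrite big_cons.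
  by rewrite RintegralD// EY ES addr0.
- apply: eq_integrable (integrableD measurableT iD iS2) => // w _ /=.
  by rewrite sqE.
- under eq_Rintegral do rewrite sqE.
  by rewrite RintegralD// RintegralD// RintegralZl// ESY mulr0 addr0 ES2 big_cons.
Qed.

Definition tail_mean X (tau : R) : R := \int[P]_w (X w * (tau < X w)%R%:R).

Lemma integrable_tail X tau : measurable_fun setT X ->
  P.-integrable setT (EFin \o X) ->
  P.-integrable setT (EFin \o (fun w => X w * (tau < X w)%R%:R)).
Proof.
move=> mX iX; apply: (le_integrable measurableT _ _ iX).
  apply/measurable_EFinP; apply: measurable_funM => //.
  rewrite (_ : (fun w => _) = \1_[set w | tau < X w]); last first.
    by apply/funext => w; rewrite indic_boolE.
  apply: measurable_indic; rewrite -[X in measurable X]setTI.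
  have := measurable_fun_ltr (measurable_cst tau) mX.
  by move=> /(_ measurableT [set true] I).
move=> w _ /=; rewrite lee_fin normrM ler_piMr// ger0_norm//.
by case: (_ < _).
Qed.

Lemma tail_mean_le X tau tau' : measurable_fun setT X -> (forall w, 0 <= X w) ->
  P.-integrable setT (EFin \o X) -> tau <= tau' ->
  tail_mean X tau' <= tail_mean X tau.
Proof.
move=> mX X0 iX tt'; apply: le_Rintegral => //; try exact: integrable_tail.
move=> w _; rewrite ler_wpM2l// ler_nat.
by case: (ltP tau' (X w)) => // /(le_lt_trans tt') ->.
Qed.

(** Dominated convergence along integer thresholds, with X itself as the dominating function. *)
Lemma tail_mean_cvg0 X delta : measurable_fun setT X -> (forall w, 0 <= X w) ->
  P.-integrable setT (EFin \o X) -> 0 < delta ->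
  exists tau, tail_mean X tau <= delta.
Proof.
move=> mX X0 iX d0.
pose f_ (n : nat) := EFin \o (fun w => X w * (n%:R < X w)%R%:R).
have [//|||_ _ Hcvg] := @dominated_convergence _ _ _ P setT measurableT f_
    (cst 0%E) (EFin \o X) _ (measurable_cst _) _ iX _.
- by move=> n; apply: measurable_int (integrable_tail n%:R mX iX).
- apply: aeW => w _; apply: cvg_near_cst; near=> n.
  rewrite /f_ /= ltNge (_ : X w <= n%:R) ?mulr0//.
  by near: n; exact: nbhs_infty_ger.
- apply: aeW => w n _; rewrite /f_ /= lee_fin normrM ger0_norm// ler_piMr//.
  by rewrite ger0_norm//; case: (_ < _).
have : (\int[P]_w f_ n w @[n --> \oo] --> 0%:E)%E.
  by move: Hcvg; rewrite integral0.
move=> /fine_cvg /cvgrPdist_le /(_ _ d0) [n _ /(_ n (leqnn n))].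
rewrite /= sub0r normrN => h; exists n%:R.
by rewrite (le_trans _ h)// ler_norm.
Unshelve. all: by end_near. Qed.

End centered_moments.

(** * Growth of the level sums under Assumption B *)

Lemma limn_einf_gt_near (R : realType) (u : nat -> \bar R) (a : \bar R) :
  (a < limn_einf u)%E -> \forall n \near \oo, (a < u n)%E.
Proof.
rewrite limn_einf_lim (cvg_lim _ (@cvg_einfs_sup _ u))// => au.
have [n an] : exists n, (a < einfs u n)%E.
  apply/not_existsP => H; move: au; apply/negP; rewrite -leNgt.
  by apply: ge_ereal_sup => _ [n _ <-]; rewrite leNgt; apply/negP; exact: H.
exists n => // k /= nk; apply: (lt_le_trans an).
by apply: ereal_inf_lbound; exists k.
Qed.

Lemma expR_mul_cvgy (R : realType) (a : R) : 0 < a ->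
  expR (a * k%:R) @[k --> \oo] --> +oo.
Proof.
move=> a0; apply/cvgryPge => A; near=> k.
apply: (le_trans _ (expR_ge1Dx _)).
apply: (@le_trans _ _ (a * k%:R)); last by rewrite lerDr.
rewrite -ler_pdivrMl//; near: k; exact: nbhs_infty_ger.
Unshelve. all: by end_near. Qed.

(** If beta = gamma, the minimum condition gives gamma <= 2 alpha, so the exponential is at least 1
    and S_k^2 diverges. Otherwise the expression is e^((2 alpha - upsilon) k) times the square of a
    quantity eventually above 1. *)
Lemma assumptionB_level_sum_cvg (R : realType) (S : nat -> R)
    (alpha beta gamma : R) :
  (forall k, 0 < S k) -> Num.min beta gamma <= 2 * alpha -> beta <= gamma ->
  (beta = gamma -> S k @[k --> \oo] --> +oo) ->
  (beta < gamma -> beta < 2 * alpha /\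
     exists upsilon, beta <= upsilon /\ upsilon < 2 * alpha /\
       (1 < limn_einf (fun k : nat =>
              (S k * expR ((upsilon - gamma) * k%:R / 2))%:E))%E) ->
  (expR ((2 * alpha - gamma) * k%:R) * S k ^+ 2) @[k --> \oo] --> +oo.
Proof.
move=> S0 mina; rewrite le_eqVlt => /predU1P[bg /(_ bg) HS _|bg _ /(_ bg)].
  rewrite bg minxx in mina; apply/cvgryPge => A.
  have /cvgryPge HS' := HS.
  near=> k.
  have h1 : 1 <= S k by near: k; exact: HS'.
  have hA : A <= S k by near: k; exact: HS'.
  apply: (le_trans hA); apply: (@le_trans _ _ (S k ^+ 2)).
    by rewrite expr2 ler_peMl// ltW.
  by rewrite ler_peMl ?sqr_ge0// -[leLHS]expR0 ler_expR mulr_ge0// subr_ge0.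
move=> [_ [ups [_ [ua /limn_einf_gt_near Hn]]]]; apply/cvgryPge => A.
have u0 : 0 < 2 * alpha - ups by rewrite subr_gt0.
have /cvgryPge /(_ A) HA := expR_mul_cvgy u0.
near=> k.
have h1 : 1 < S k * expR ((ups - gamma) * k%:R / 2).
  by rewrite -lte_fin; near: k; exact: Hn.
have hA : A <= expR ((2 * alpha - ups) * k%:R) by near: k; exact: HA.
apply: (le_trans hA).
have -> : (2 * alpha - gamma) * k%:R = (2 * alpha - ups) * k%:R +
   ((ups - gamma) * k%:R / 2 + (ups - gamma) * k%:R / 2) by field.
rewrite !expRD; set a := expR _; set b := expR ((ups - gamma) * k%:R / 2).
have -> : a * (b * b) * S k ^+ 2 = a * (S k * b) ^+ 2 by ring.
by rewrite ler_peMr ?expR_ge0// exprn_ege1// ltW.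
Unshelve. all: by end_near. Qed.

(** * Sample indices and rescaled truncation *)

Section mlmc_lindeberg.
Context d (T : measurableType d) (R : realType) (P : probability T R).

Definition sample_indices (L : nat) (M : nat -> nat) : seq (nat * nat) :=
  [seq (l, i) | l <- index_iota 0 L.+1, i <- index_iota 0 (M l)].

Lemma sample_indices_uniq L M : uniq (sample_indices L M).
Proof.
apply: allpairs_uniq_dep; first exact: iota_uniq.
  by move=> l _; exact: iota_uniq.
by move=> [l i] [l' i'] _ _ /= [-> ->].
Qed.

Lemma mem_sample_indices L M l i : (l, i) \in sample_indices L M -> (l <= L)%N.
Proof.
by move=> /allpairsPdep[l' [i' [+ _ [-> _]]]]; rewrite mem_index_iota.
Qed.

Lemma sum_sample_indices L M (F : nat * nat -> R) :
  \sum_(j <- sample_indices L M) F j = \sum_(l < L.+1) \sum_(i < M l) F (nat_of_ord l, nat_of_ord i).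
Proof.
rewrite /sample_indices big_allpairs_dep big_mkord.
by apply: eq_bigr => l _; rewrite big_mkord.
Qed.

(** Telescoping, with X_0 itself as the level 0 term. *)
Lemma sum_mean_Delta (Xs : nat -> T -> R) k :
  (forall l, P.-integrable setT (EFin \o Xs l)) ->
  \sum_(l < k.+1) fine ('E_P[Delta Xs l]) = fine ('E_P[Xs k]).
Proof.
move=> iX; elim: k => [|k IH]; first by rewrite big_ord1.
rewrite big_ord_recr/= IH !expectation.unlock /=.
transitivity (\int[P]_w Xs k w + \int[P]_w (Xs k.+1 w - Xs k w)) => //.
by rewrite RintegralB// addrC subrK.
Qed.

(* Applied with [v] the variance of [Z] and [k] the scaling
   [M_l * sqrt (Var A_ML)]. *)
Lemma trunc2_scaled (Z Y : T -> R) (m v k nu : R) :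
  measurable_fun setT Z -> measurable_fun setT Y -> same_law P Y Z ->
  P.-integrable setT (EFin \o (fun w => (Z w - m) ^+ 2)) ->
  0 < v -> 0 < k -> 0 < nu ->
  trunc2 P nu (fun w => (Y w - m) / k) =
  v / k ^+ 2 * tail_mean P (fun w => (Z w - m) ^+ 2 / v) (nu ^+ 2 * k ^+ 2 / v).
Proof.
move=> mZ mY YZ iZ v0 k0 nu0.
pose f (x : R) := ((x - m) / k) ^+ 2 * (nu < `|(x - m) / k|)%R%:R.
have mf : measurable_fun setT f.
  apply: (@measurable_trunc2 _ R R nu (fun x : R => (x - m) / k)).
  by apply: measurable_funM => //; exact: measurable_funB.
have mZk : measurable_fun setT (fun w => (Z w - m) / k).
  by apply: measurable_funM => //; exact: measurable_funB.
have ifZ : P.-integrable setT (EFin \o (f \o Z)).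
  apply: (@integrable_trunc2 _ _ _ P nu (fun w => (Z w - m) / k)) => //.
  apply: eq_integrable (integrableZr measurableT (k ^- 2) iZ) => // w _ /=.
  by rewrite -EFinM exprMn exprVn.
have [_ E] := same_law_integrable mY mZ YZ mf ifZ.
rewrite /trunc2 [LHS]E /tail_mean -RintegralZl//; last first.
  apply: integrable_tail.
    by apply: measurable_funM => //; apply: measurable_funX; exact: measurable_funB.
  exact: (integrableZr measurableT v^-1 iZ).
apply: eq_Rintegral => w _; rewrite /f mulrA; congr (_ * _%:R).
  by field; rewrite !gt_eqF.
congr nat_of_bool.
rewrite ltr_pdivrMr// divfK ?gt_eqF// normrM normfV (gtr0_norm k0) ltr_pdivlMr//.
rewrite -exprMn -[in RHS](real_normK (num_real (Z w - m))).
by rewrite ltr_pXn2r ?nnegrE// mulr_ge0// ltW.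
Qed.

End mlmc_lindeberg.

(** * The extended CLT condition *)

Unset Implicit Arguments. Set Strict Implicit. Set Printing Implicit Defensive.

Theorem theorem3 (d : measure_display) (T : measurableType d) (R : realType)
  (P : probability T R)
  (X : T -> R) (Xs : nat -> T -> R) (Cost : nat -> R) (D : nat * nat -> T -> R)
  (alpha beta gamma calpha CV c C' : R) :
  (* X, X_l in L^2 *)
  X \in Lfun P 2%:E -> (forall l, Xs l \in Lfun P 2%:E) ->
  (* i.i.d. copies of the Delta_l X *)
  mutually_independent P D ->
  (forall l i, same_law P (D (l, i)) (Delta Xs l)) ->
  (* Assumption A *)
  0 < alpha -> 0 < beta -> 0 < gamma -> Num.min beta gamma <= 2 * alpha ->
  0 < calpha ->
  (forall l : nat,
     (`| 'E_P[X \- Xs l] | <= (calpha * expR (- alpha * l%:R))%:E)%E) ->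
  0 < CV -> (forall l : nat, Vl P Xs l <= CV * expR (- beta * l%:R)) ->
  0 < c -> c < C' ->
  (forall l : nat, c * expR (gamma * l%:R) < Cost l /\
                   Cost l < C' * expR (gamma * l%:R)) ->
  (* gamma >= beta *)
  beta <= gamma ->
  (* Assumption B *)
  0 < Vl P Xs 0 ->
  (beta = gamma -> Sk P Xs Cost k @[k --> \oo] --> +oo) ->
  (beta < gamma -> beta < 2 * alpha /\
     exists upsilon, beta <= upsilon /\ upsilon < 2 * alpha /\
       (1 < limn_einf (fun k : nat =>
              (Sk P Xs Cost k * expR ((upsilon - gamma) * k%:R / 2))%:E))%E) ->
  (* Lindeberg-type condition *)
  (forall nu : R, 0 < nu ->
     (fun l : nat =>
        if 0 < Vl P Xs l then
          ('E_P[(fun w =>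
                 ((Delta Xs l w - fine ('E_P[Delta Xs l])%E) ^+ 2 / Vl P Xs l) *
                 \1_[set w' | (Delta Xs l w' - fine ('E_P[Delta Xs l])%E) ^+ 2
                                / Vl P Xs l >
                              expR ((2 * alpha - gamma) * l%:R)
                                * Sk P Xs Cost l ^+ 2 * nu] w)%R])%E
        else 0%E) @ \oo --> 0%E) ->
  extended_CLT P Xs Cost D alpha calpha.
Proof.
move=> _ Xs2 indD lawD a0 _ g0 mina ca0 _ _ _ c0 _ HC bg V0 HS1 HS2 Lind.
set v := Vl P Xs; pose m l := fine ('E_P[Delta Xs l]).
have Delta2 l : Delta Xs l \in Lfun P 2%:E.
  by case: l => [|l] /=; [exact: Xs2|rewrite rpredB ?lee1n//=].
have mDelta l := Lfun2_measurable (Delta2 l).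
have cDelta l := Lfun2_centered (Delta2 l).
have v_ge0 l : 0 <= v l by rewrite fine_ge0// variance_ge0.
have C_gt0 l : 0 < Cost l.
  by apply: lt_trans (HC l).1; rewrite mulr_gt0// expR_gt0.
have C_le l : Cost l <= C' * expR (gamma * l%:R) by exact: ltW (HC l).2.
have S_gt0 k : 0 < Sk P Xs Cost k by exact: level_sum_gt0.
have K_cvg := assumptionB_level_sum_cvg S_gt0 mina bg HS1 HS2.
pose L := Leps alpha calpha.
pose M e l := Meps P Xs Cost alpha calpha e l.
pose var e := mlmc_var v Cost alpha calpha e.
have M_gt0 e l : 0 < (M e l)%:R :> R by exact: samples_gt0.
have var_gt0 e : 0 < var e by exact: mlmc_var_gt0.
pose J e := sample_indices (L e) (M e).
have sumJ e (F : nat -> R) : \sum_(j <- J e) F j.1 = \sum_(l < (L e).+1) (M e l)%:R * F l.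
  rewrite sum_sample_indices; apply: eq_bigr => l _ /=.
  by rewrite sumr_const card_ord mulr_natl.
have mD j : measurable_fun setT (D j) by have [] := indD.
(* Used with two scalings: M_l for the variance of the estimator, and M_l times its standard
   deviation for the normalized summands. *)
have scaled (j : nat * nat) (k : R) :
  [/\ P.-integrable setT (EFin \o (fun w => (D j w - m j.1) / k)),
      \int[P]_w ((D j w - m j.1) / k) = 0,
      P.-integrable setT (EFin \o (fun w => ((D j w - m j.1) / k) ^+ 2)) &
      \int[P]_w (((D j w - m j.1) / k) ^+ 2) = v j.1 / k ^+ 2].
  case: j => l i /=; have [i1 E1 i2 E2] := cDelta l.
  have mf : measurable_fun setT (fun x : R => x - m l) by exact: measurable_funB.
  have mf2 : measurable_fun setT (fun x : R => (x - m l) ^+ 2) by exact: measurable_funX.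
  have [j1 F1] := same_law_integrable (mD (l, i)) (mDelta l) (lawD l i) mf i1.
  have [j2 F2] := same_law_integrable (mD (l, i)) (mDelta l) (lawD l i) mf2 i2.
  split.
  - exact: (integrableZr measurableT k^-1 j1).
  - by rewrite RintegralZr// F1 E1 mul0r.
  - apply: eq_integrable (integrableZr measurableT (k ^- 2) j2) => // w _ /=.
    by rewrite -EFinM exprMn exprVn.
  - under eq_Rintegral do rewrite exprMn exprVn.
    by rewrite RintegralZr// F2 E2.
have ind_scaled (k : nat -> R) :
    mutually_independent P (fun j w => (D j w - m j.1) / k j.1).
  apply: (mutually_independent_comp (g := fun j x => (x - m j.1) / k j.1)) => // j.
  by apply: measurable_funM => //; exact: measurable_funB.
have uJ e : uniq (J e) by exact: sample_indices_uniq.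
have AMLE e w : AML P Xs Cost D alpha calpha e w =
    \sum_(j <- J e) (D j w - m j.1) / (M e j.1)%:R + fine ('E_P[Xs (L e)]).
  rewrite -sum_mean_Delta; last by move=> l; exact: Lfun2_integrable.
  rewrite sum_sample_indices -big_split; apply: eq_bigr => l _ /=.
  rewrite -mulr_suml sumrB sumr_const card_ord -mulr_natl -/(m l).
  by field; rewrite gt_eqF.
have varE e : fine ('V_P[AML P Xs Cost D alpha calpha e]) = var e.
  rewrite (_ : AML _ _ _ _ _ _ _ = fun w => \sum_(j <- J e)
    (D j w - m j.1) / (M e j.1)%:R + fine ('E_P[Xs (L e)])); last first.
    by apply/funext => w; exact: AMLE.
  have [iS ES _ ES2] := independent_sum_sqr (ind_scaled (fun l => (M e l)%:R)) (uJ e)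
    (fun j => let: And4 h _ _ _ := scaled j (M e j.1)%:R in h)
    (fun j => let: And4 _ h _ _ := scaled j (M e j.1)%:R in h)
    (fun j => let: And4 _ _ h _ := scaled j (M e j.1)%:R in h).
  rewrite variance_shift//; last first.
    apply: measurable_sum => j; apply: measurable_funM => //.
    exact: measurable_funB.
  rewrite ES2; transitivity (\sum_(j <- J e) (v j.1 / (M e j.1)%:R ^+ 2)).
    by apply: eq_bigr => j _; have [_ _ _ ->] := scaled j (M e j.1)%:R.
  rewrite (sumJ e (fun l => v l / (M e l)%:R ^+ 2)); apply: eq_bigr => l _.
  by field; rewrite gt_eqF.
pose k e l := (M e l)%:R * Num.sqrt (var e).
have k_gt0 e l : 0 < k e l by rewrite mulr_gt0// sqrtr_gt0.
have k2 e l : k e l ^+ 2 = (M e l)%:R ^+ 2 * var e.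
  by rewrite exprMn sqr_sqrtr// ltW.
pose s e (j : nat * nat) := Num.sqrt (v j.1) / k e j.1.
have s2 e j : s e j ^+ 2 = v j.1 / k e j.1 ^+ 2.
  by rewrite expr_div_n sqr_sqrtr.
have s_ge0 e j : 0 <= s e j by rewrite divr_ge0// ltW.
have s1 e : \sum_(j <- J e) s e j ^+ 2 = 1.
  under eq_bigr do rewrite s2 k2.
  rewrite (sumJ e (fun l => v l / ((M e l)%:R ^+ 2 * var e))).
  transitivity ((\sum_(l < (L e).+1) v l / (M e l)%:R) / var e).
    by rewrite mulr_suml; apply: eq_bigr => l _; field; rewrite !gt_eqF.
  exact: divff (lt0r_neq0 (var_gt0 e)).
have ratio0 := sample_ratio_cvg0 v_ge0 V0 C_gt0 C_le a0 g0 ca0 K_cvg.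
(* The negligibility of the largest variance ratio comes first, directly from the uniform bound
   [ratio0]. *)
split; last first.
  apply/cvgrPdist_le => delta delta0; near=> e.
  have He : forall l, (l <= L e)%N -> v l / ((M e l)%:R ^+ 2 * var e) <= delta.
    by near: e; exact: ratio0.
  rewrite sub0r normrN varE -/(L e).
  set x := \big[_/_]_(_ < _) _.
  suff /andP[x0 xd] : 0 <= x <= delta by rewrite ger0_norm.
  rewrite /x; apply: (big_ind (fun y => 0 <= y <= delta)).
  - by rewrite lexx ltW.
  - by move=> y z; rewrite /Num.max; case: ifP.
  - move=> l _; rewrite He ?andbT; last by rewrite -ltnS.
    by rewrite divr_ge0// mulr_ge0 ?sqr_ge0// ltW.
rewrite (_ : (fun e w => _) = (fun e w => \sum_(j <- J e)
    (D j w - m j.1) / k e j.1)); last first.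
  apply/funext => e; apply/funext => w.
  rewrite varE AMLE addrK mulr_suml; apply: eq_bigr => j _.
  by rewrite -mulrA -invfM.
apply: (@lindeberg_clt _ _ _ P _ _ _ J
  (fun e j w => (D j w - m j.1) / k e j.1) s) => //.
- by move=> e j; have [] := scaled j (k e j.1).
- by move=> e j; have [] := scaled j (k e j.1).
- by move=> e j; have [] := scaled j (k e j.1).
- by move=> e j; have [_ _ _ ->] := scaled j (k e j.1); rewrite s2.
- move=> nu nu0; near=> e.
  have He : forall l, (l <= L e)%N -> v l / ((M e l)%:R ^+ 2 * var e) <= nu ^+ 2.
    by near: e; apply: ratio0; rewrite exprn_gt0.
  move=> -[l i] /mem_sample_indices lL.
  by rewrite -(ler_pXn2r (ltn0Sn 1)) ?nnegrE ?(ltW nu0)// s2 k2 He.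
move=> nu nu0; apply/cvgrPdist_le => delta delta0.
pose U l w := (Delta Xs l w - m l) ^+ 2 / v l.
have mU l : measurable_fun setT (U l).
  by apply: measurable_funM => //; apply: measurable_funX; exact: measurable_funB.
have U_ge0 l w : 0 <= U l w by rewrite divr_ge0// sqr_ge0.
have iU l : P.-integrable setT (EFin \o U l).
  by have [_ _ h _] := cDelta l; exact: (integrableZr measurableT (v l)^-1 h).
pose B := calpha * expR alpha.
have B_gt0 : 0 < B by rewrite mulr_gt0// expR_gt0.
have C'_gt0 : 0 < C'.
  by have := lt_le_trans (C_gt0 0%N) (C_le 0%N); rewrite mulr0 expR0 mulr1.
(* Since q_l <= 2 C' B^2 / K_l, the truncation level nu^2 / q_l is at least K_l nu', where the
   hypothesis applies. *)
pose nu' := nu ^+ 2 / (2 * C' * B ^+ 2).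
have nu'_gt0 : 0 < nu' by rewrite divr_gt0 ?exprn_gt0// mulr_gt0 ?exprn_gt0// mulr_gt0.
have [l0 Hl0] : exists l0, forall l, (l0 <= l)%N -> 0 < v l ->
    tail_mean P (U l) (expR ((2 * alpha - gamma) * l%:R) * Sk P Xs Cost l ^+ 2 * nu') <= delta.
  have /fine_cvg /cvgrPdist_le /(_ _ delta0) [l0 _ H] := Lind _ nu'_gt0.
  exists l0 => l /H /= + vl; rewrite -/v vl sub0r normrN => /(le_trans (ler_norm _)).
  apply: le_trans; rewrite -/(m l) expectation.unlock le_eqVlt; apply/orP; left; apply/eqP.
  by apply: eq_Rintegral => w _; rewrite indic_boolE.
have /choice[t Ht] l : exists tau, tail_mean P (U l) tau <= delta.
  exact: tail_mean_cvg0.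
(* A common threshold for the finitely many levels below l0, made positive by the extra 1. *)
pose tau := \sum_(l < l0) `|t l| + 1.
have tau_gt0 : 0 < tau by rewrite ltr_wpDl// sumr_ge0.
have t_tau l : (l < l0)%N -> t l <= tau.
  move=> ll0; rewrite /tau (bigD1 (Ordinal ll0))//= -addrA.
  by apply: (le_trans (ler_norm _)); rewrite lerDl addr_ge0// sumr_ge0.
have tau_nu : 0 < nu ^+ 2 / tau by rewrite divr_gt0// exprn_gt0.
near=> e.
(* Equivalently, the truncation level nu^2 / q_l is at least tau when q_l > 0. *)
have H1 : forall l, (l <= L e)%N -> v l / ((M e l)%:R ^+ 2 * var e) <= nu ^+ 2 / tau.
  by near: e; exact: ratio0.
have H2 : forall l, (l <= L e)%N -> v l / ((M e l)%:R ^+ 2 * var e) <=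
    2 * C' * B ^+ 2 / (expR ((2 * alpha - gamma) * l%:R) * Sk P Xs Cost l ^+ 2).
  by near: e; exact: (sample_ratio_le v_ge0 V0 C_gt0 C_le a0 g0 ca0 K_cvg).
have trunc_ge0 j : 0 <= trunc2 P nu (fun w => (D j w - m j.1) / k e j.1).
  by apply: Rintegral_ge0 => w _; rewrite mulr_ge0 ?sqr_ge0.
rewrite sub0r normrN ger0_norm ?sumr_ge0//.
(* The s_j^2 add up to 1, so delta is split as the sum of the delta s_j^2; each truncated moment is
   q_l = s_j^2 times a tail mean that has to be at most delta. *)
rewrite -[leRHS]mulr1 -(s1 e) mulr_sumr big_seq [leRHS]big_seq.
apply: ler_sum => -[l i] /mem_sample_indices lL; rewrite s2 /=.
(* When v_l = 0, dividing by it is meaningless; the truncated moment is then at most the full second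
   moment, which is 0. *)
have [vl|vl] := ltP 0 (v l); last first.
  have v0 : v l = 0 by apply/eqP; rewrite eq_le vl v_ge0.
  have [_ _ iY2 EY2] := scaled (l, i) (k e l); rewrite v0 mul0r mulr0.
  rewrite /= v0 mul0r in EY2; rewrite -EY2.
  apply: le_Rintegral => //.
    apply: integrable_trunc2 => //; apply: measurable_funM => //.
    exact: measurable_funB.
  by move=> w _; rewrite ler_piMr ?sqr_ge0//; case: (_ < _).
rewrite (trunc2_scaled (mDelta l) (mD (l, i)) (lawD l i) _ vl (k_gt0 e l) nu0); last first.
  by have [] := cDelta l.
rewrite mulrC ler_wpM2r ?divr_ge0 ?sqr_ge0//.
have q_gt0 : 0 < v l / k e l ^+ 2 by rewrite divr_gt0 ?exprn_gt0.
have -> : nu ^+ 2 * k e l ^+ 2 / v l = nu ^+ 2 / (v l / k e l ^+ 2).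
  by field; rewrite !gt_eqF.
have [ll0|ll0] := ltnP l l0.
  apply: le_trans (Ht l); apply: (tail_mean_le (mU l) (U_ge0 l) (iU l)).
  apply: (le_trans (t_tau l ll0)); rewrite ler_pdivlMr// mulrC -ler_pdivlMr//.
  by rewrite k2 H1.
apply: le_trans (Hl0 l ll0 vl); apply: (tail_mean_le (mU l) (U_ge0 l) (iU l)).
rewrite ler_pdivlMr// k2 /nu'.
have ES_gt0 : 0 < expR ((2 * alpha - gamma) * l%:R) * Sk P Xs Cost l ^+ 2.
  by rewrite mulr_gt0 ?expR_gt0// exprn_gt0.
have CB_gt0 : 0 < 2 * C' * B ^+ 2 by rewrite mulr_gt0 ?exprn_gt0// mulr_gt0.
apply: (le_trans (ler_wpM2l _ (H2 l lL))).
  by rewrite mulr_ge0 ?(ltW ES_gt0)// divr_ge0 ?sqr_ge0// ltW.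
rewrite le_eqVlt; apply/orP; left; apply/eqP.
move: (expR _ * _) ES_gt0 => x x0; field.
by rewrite !gt_eqF.
Unshelve. all: by end_near. Qed.
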